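(* Assume that $(r(m))$ is a regularly varying sequence such that $\sum_{m} r(m)^{-2}=\infty$. Let $\mu(n)$, $n\ge1$, be a sequence of real numbers such that $$\sum_{k=1}^{\mu(n)}\frac1{r(k)}=\log n+O(1),$$ and let $$\beta(m)^2:=r(m)^2\sum_{k=1}^m\frac1{r(k)^2}=\sum_{k=1}^m\frac{r(m)^2}{r(k)^2}\quad(\beta(m)\ge 0),\qquad \gamma(n):=\beta\bigl(\lfloor\mu(n)\rfloor\bigr).$$ Then, as $n\to\infty$, $$\frac{M_n-\mu(n)}{\gamma(n)}\longrightarrow N(0,1)\quad\text{in distribution}.$$ Furthermore, this convergence in distribution is mixing.
   Context: Hiring process. $(r(m))_{m\ge0}$ is a given sequence of integers with $r(0)=1$ and $r(m)\le r(m+1)\le r(m)+1$ for all $m\ge0$ (hence $1\le r(m)\le m+1$). The values $X_1,X_2,\dots$ of the candidates are i.i.d. random variables with a common continuous distribution (so they are a.s. distinct). Candidates are examined one by one in the order $1,2,\dots$. If $m\ge0$ candidates have been accepted so far, then: if $r(m)\le m$, the next candidate is accepted if and only if her value exceeds the $r(m)$-th largest of the $m$ values already accepted; if $r(m)=m+1$, the next candidate is always accepted. (The law of the sequence of accept/reject decisions does not depend on the continuous distribution.) $M_n$ is the number of candidates accepted among the first $n$. A sequence $(c_m)$ of positive numbers is regularly varying if for every $\lambda>0$ the limit $\lim_{m\to\infty}c_{\lfloor\lambda m\rfloor}/c_m$ exists in $(0,\infty)$. The sum up to $\mu(n)$ is over integers $k$ with $1\le k\le\mu(n)$; necessarily $\mu(n)\to\infty$,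 and only $n$ with $\mu(n)\ge1$ are considered in the limit. A limit theorem $\xi_n\to\xi$ in distribution is mixing (in the sense of Rényi) if for every event $B$ with $\mathbb P(B)>0$, the conditional distribution of $\xi_n$ given $B$ also converges to the distribution of $\xi$. *)

(* Defs.v *)
From HB Require Import structures.
From mathcomp Require Import all_boot all_order all_algebra.
From mathcomp Require Import finmap.
From mathcomp Require Import all_classical all_reals all_analysis.

Set Implicit Arguments.
Unset Strict Implicit.
Unset Printing Implicit Defensive.

Import Order.TTheory GRing.Theory Num.Theory.
Import numFieldNormedType.Exports.

Local Open Scope classical_set_scope.
Local Open Scope ring_scope.

Definition rank_sequence (r : nat -> nat) : Prop :=
  r 0%N = 1%N /\ forall m, (r m <= r m.+1 <= (r m).+1)%N.

Definition regularly_varying (R : realType) (c : nat -> R) : Prop :=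
  (forall m, 0 < c m) /\
  forall lambda : R, 0 < lambda ->
    exists2 l : R, 0 < l &
      c (Num.truncn (lambda * m%:R)) / c m @[m --> \oo] --> l.

Section hiring.
Context {R : realType}.
Variable r : nat -> nat.

(* Decision on the value [x] when [s] lists the values accepted so far; the
   [k]-th largest element of [s] has index [k.-1] in the decreasing sort. *)
Definition accepts (s : seq R) (x : R) : bool :=
  if (r (size s) <= size s)%N
  then nth 0 (sort >=%R s) (r (size s)).-1 < x
  else true.

(* [x i] is the value of the candidate examined at step [i.+1]. *)
Fixpoint accepted (x : nat -> R) (n : nat) : seq R :=
  if n is n'.+1 then
    let s := accepted x n' in
    if accepts s (x n') then rcons s (x n') else s
  else [::].

Definition num_accepted (x : nat -> R) (n : nat) : nat := size (accepted x n).

Definition beta (m : nat) : R :=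
  Num.sqrt ((r m)%:R ^+ 2 * \sum_(1 <= k < m.+1) (r k)%:R ^- 2).

End hiring.

Section probability_notions.
Context d (T : measurableType d) (R : realType).

Definition mutually_independent (I : choiceType) (P : probability T R)
    (X : I -> {RV P >-> R}) : Prop :=
  forall (J : {fset I}) (A : I -> set R), (forall i, measurable (A i)) ->
    P (\bigcap_(i in [set` J]) (X i @^-1` A i)) =
    (\prod_(i <- J) P (X i @^-1` A i))%E.

Definition identically_distributed (I : Type) (P : probability T R)
    (X : I -> {RV P >-> R}) : Prop :=
  forall (i j : I) (A : set R), measurable A ->
    distribution P (X i) A = distribution P (X j) A.

Definition cvg_in_distribution (P : probability T R) (xi : nat -> T -> R)
    (Q : probability (measurableTypeR R) R) : Prop :=
  forall t : R, {for t, continuous (fun u : R => Q `]-oo, u]%classic)} ->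
    P (xi n @^-1` `]-oo, t]%classic) @[n --> \oo] --> Q `]-oo, t]%classic.

(* The conditional probability given [B]; when [P B = 0], [mnormalize]
   returns its second argument [P]. *)
Definition cond_probability (P : probability T R) (B : set T)
    (mB : measurable B) : probability T R :=
  mnormalize (mrestr P mB) P.

(* Mixing in the sense of Renyi *)
Definition mixing_cvg_in_distribution (P : probability T R)
    (xi : nat -> T -> R) (Q : probability (measurableTypeR R) R) : Prop :=
  forall (B : set T) (mB : measurable B), (0 < P B)%E ->
    cvg_in_distribution (cond_probability P mB) xi Q.

End probability_notions.

(* Main.v *)
Require Import Defs.
From HB Require Import structures.
From mathcomp Require Import all_boot all_order all_algebra.
From mathcomp Require Import finmap.
From mathcomp Require Import all_classical all_reals all_analysis.
From mathcomp Require Import measurable_realfun ring lra zify.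

Set Implicit Arguments.
Unset Strict Implicit.
Unset Printing Implicit Defensive.

Import Order.TTheory GRing.Theory Num.Theory.
Import numFieldNormedType.Exports.

Local Open Scope classical_set_scope.
Local Open Scope ring_scope.

(* Pathwise, a rejected candidate stays below the threshold forever, so the
   threshold is the r(m)-th largest of all the values seen so far, and the next
   candidate is accepted iff fewer than r(m) earlier values dominate hers.  By
   exchangeability her relative rank is uniform and independent of the past,
   hence (M_n) is a Markov chain that steps from m to m+1 at time n with
   probability r(m) / (n+1).

   Put g(m) = sum_(k < m) 1/r(k), V(m) = sum_(k < m) 1/r(k)^2 and let H_n be the
   harmonic sum.  Then g(M_n) - H_n is a martingale whose bracket is V(M_n) up to
   a bounded term.  Since Phi(y / sqrt t) solves the heat equation, the function
     Phi ((g(m') - g(m) + H_n - a) / sqrt (V(m') - V(m) + t0))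
   of the state (n, m) is almost harmonic for the chain; its one-step errors are
   absorbed by an explicit Lyapunov function.  With t0 = eta^2 V(m') it is a
   smoothed indicator at the final time, so comparing super- and subsolutions
   gives the limit of P(M_n < m') from any fixed starting state, with no need for
   characteristic functions.  Regular variation and the divergence of
   sum 1/r(m)^2 give beta(m) = o(m), so that r is almost constant on the window
   of width beta around mu(n), where g can be linearized.

   As the limit does not depend on the starting state, the events
   E_n = {M_n <= mu(n) + t gamma(n)} satisfy P(E_k & E_n) -> P(E_k) Phi(t) for
   each k, and the orthogonality argument of Renyi gives mixing. *)

(** * Reduction to relative ranks *)

(** The variance inside [Phi] is read off the state, as V(m') - V(m), and not off the clock, so no
    law of large numbers for the bracket is needed. This variance vanishes as m approaches m', where
    the heat equation degenerates; adding t0 keeps it away from 0. A step of size s = 1/r(m), taken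
    with probability p out of time j, costs at most a constant times (j+1)^(-2) / t0 + p s^3 /
    t0^(3/2). The first costs sum to O(1/t0). The second sum to at most V(m') / t0^(3/2), because s
    <= 1 and p s^2 is the mean increment of V. With t0 of order eta^2 V(m') both vanish, since V
    diverges. What remains is the blur eta: moving the profile by K sqrt t0 to either side yields an
    upper and a lower bound for the probability. *)

Lemma nth_sorted_lt (R : realType) (s : seq R) (y : R) (i : nat) :
  sorted >=%R s -> (i < size s)%N ->
  (nth 0 s i < y) = (count (fun z => y <= z)%R s <= i)%N.
Proof.
elim: s i => [//|a s IHs] i /= /[dup] /path_sorted ss pas.
have [ya|ay] := leP y a.
  case: i => [_|i] /=; first by rewrite ltNge ya.
  by rewrite add1n !ltnS => ?; exact: IHs.
move=> isz; rewrite add0n.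
have /allP sa : all (fun z => z <= a) s.
  by apply: order_path_min pas => u v w; exact: ge_trans.
have -> : count (fun z => y <= z) s = 0%N.
  apply/eqP; rewrite -leqn0 leqNgt -has_count; apply/hasPn => z /sa za.
  by rewrite -ltNge (le_lt_trans za).
case: i isz => [//|i]; rewrite ltnS => isz /=.
by rewrite leq0n (le_lt_trans _ ay)// sa// mem_nth.
Qed.

Lemma rank_sequence_le r m : rank_sequence r -> (r m <= m.+1)%N.
Proof.
move=> [r0 rS]; elim: m => [|m IH]; first by rewrite r0.
by case/andP: (rS m) => _ /leq_trans; apply; rewrite ltnS.
Qed.

Lemma rank_sequence_mono r m n : rank_sequence r -> (m <= n)%N ->
  (r m <= r n)%N.
Proof.
move=> [_ rS] /subnK <-; elim: (n - m)%N => [//|k]; rewrite addSn => /leq_trans.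
by apply; case/andP: (rS (k + m)%N).
Qed.

Lemma rank_sequence_gt0 r m : rank_sequence r -> (0 < r m)%N.
Proof.
by move=> rP; have := rank_sequence_mono rP (leq0n m); case: rP => -> _.
Qed.

(** In the branch that always accepts, r exceeds the size, hence any count, so one inequality covers
    both branches. *)
Lemma acceptsE (R : realType) r (s : seq R) (y : R) : rank_sequence r ->
  accepts r s y = (count (fun z => y <= z)%R s < r (size s))%N.
Proof.
move=> rP; rewrite /accepts; have r0 := rank_sequence_gt0 (size s) rP.
have [rs|sr] := leqP (r (size s)) (size s).
  have ss : sorted >=%R (sort >=%R s).
    by apply: sort_sorted => u v; exact: le_total.
  rewrite nth_sorted_lt ?size_sort//; last by rewrite prednK.
  have /seq.permP -> := permEl (perm_sort >=%R s).
  by rewrite -ltnS prednK.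
by rewrite (leq_ltn_trans (count_size _ _) sr).
Qed.

Definition ranking (R : realType) (x : nat -> R) (n : nat) : nat :=
  count (fun z => x n <= z) (mkseq x n).

(* The number of accepted candidates when the [i]-th one is dominated by [c i] of
   the earlier ones. *)
Fixpoint hired (r c : nat -> nat) (n : nat) : nat :=
  if n is n'.+1 then (hired r c n' + (c n' < r (hired r c n')))%N else 0%N.

(* A rejected candidate stays below the threshold forever, so the threshold is
   the r(m)-th largest of all the values seen so far. *)
Lemma count_accepted (R : realType) r (x : nat -> R) n (y : R) :
  rank_sequence r ->
  (count (fun z => y <= z)%R (accepted r x n) < r (num_accepted r x n))%N ->
  count (fun z => y <= z) (accepted r x n) = count (fun z => y <= z) (mkseq x n).
Proof.
move=> rP; elim: n y => [//|n IH] y.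
rewrite mkseqS -cats1 count_cat /num_accepted /= acceptsE// addn0.
set s := accepted r x n.
have sub u v : u <= v ->
    (count (fun z => v <= z)%R s <= count (fun z => u <= z)%R s)%N.
  by move=> uv; apply: sub_count => z /=; exact: le_trans.
case: ifPn => [acc|].
  rewrite size_rcons -cats1 count_cat /= addn0 => H; congr (_ + _)%N.
  apply: IH; rewrite -/s /num_accepted -/s.
  (* If y <= x n, the count grew by one and r by at most one, so the strict bound held before;
     otherwise the acceptance of x n already bounds the smaller count at y. *)
  have [yz|zy] := leP y (x n).
    move: H; rewrite yz addn1 => H; rewrite -ltnS (leq_trans H)//.
    by case: rP => _ /(_ (size s)) /andP[].
  by rewrite (leq_ltn_trans (sub _ _ (ltW zy))).
rewrite -leqNgt => rej H.
have -> : (y <= x n) = false.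
  apply/negbTE/negP => /sub; apply/negP; rewrite -ltnNge.
  exact: leq_trans H rej.
by rewrite addn0; apply: IH.
Qed.

(** Accepted values are among the earlier ones, so a small rank forces a small count; the converse
    is [count_accepted] at y = x n. *)
Lemma num_acceptedE (R : realType) r (x : nat -> R) n :
  rank_sequence r -> num_accepted r x n = hired r (ranking x) n.
Proof.
move=> rP; elim: n => [//|n IH] /=; rewrite -IH /num_accepted /=.
rewrite acceptsE//; set s := accepted r x n.
suff -> : (ranking x n < r (size s))%N =
          (count (fun z => x n <= z)%R s < r (size s))%N.
  by case: ifP => _; rewrite ?size_rcons ?addn1 ?addn0.
apply/idP/idP => [|H]; last by rewrite /ranking -(count_accepted rP).
apply: leq_ltn_trans.
suff /(_ (fun z => x n <= z)) : forall p,
  (count p s <= count p (mkseq x n))%N by [].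
move=> p; rewrite {}/s; elim: n {IH} => [//|n IH].
rewrite mkseqS -cats1 count_cat /= addn0.
by case: ifP => _; rewrite -?cats1 ?count_cat/= ?addn0 ?leq_add2r// (leq_trans
  IH)// leq_addr.
Qed.

(** * The standard normal distribution function *)

Section standard_normal.
Context {R : realType}.
Implicit Types x y : R.

Local Notation phi := (@normal_pdf R 0 1).

Definition normal_cdf (x : R) : R := fine (normal_prob 0 1 `]-oo, x]).

Lemma normal_cdf_ge0 x : 0 <= normal_cdf x.
Proof. by rewrite /normal_cdf fine_ge0. Qed.

Lemma normal_cdf_le1 x : normal_cdf x <= 1.
Proof.
by rewrite -lee_fin fineK ?probability_le1// fin_num_measure.
Qed.

Lemma normal_cdf_le : {homo normal_cdf : x y / x <= y}.
Proof.
move=> x y xy; rewrite fine_le ?fin_num_measure//.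
by apply: le_measure; rewrite ?inE//; exact: subitvPr.
Qed.

Lemma is_derive_normal_cdf x : is_derive x (1 : R) normal_cdf (phi x).
Proof.
have -> : normal_cdf =
    fun y => (\int[lebesgue_measure]_(t in [set` Interval -oo%O (BRight y)])
      phi t)%R.
  by [].
set F := fun y => _.
have dF : derivable F x 1 /\ derive1 F x = phi x.
  apply: (@continuous_FTC1 R phi -oo%O x (x + 1)); rewrite ?ltrDl ?ltNyr//.
    exact: integrableS (integrable_normal_pdf 0 1).
  exact: continuous_normal_pdf.
by case: dF => dF FE; apply: DeriveDef dF _; rewrite -derive1E.
Qed.

Lemma continuous_normal_cdf : continuous normal_cdf.
Proof.
move=> x; apply: differentiable_continuous; apply/derivable1_diffP.
by case: (is_derive_normal_cdf x).
Qed.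

Lemma normal_pdf01E x : phi x = normal_peak 1 * expR (- (x ^+ 2 / 2)).
Proof.
rewrite normal_pdfE// /normal_fun; congr (_ * expR _).
by rewrite subr0 mulNr expr1n.
Qed.

Lemma normal_peak1_le1 : normal_peak 1 <= 1 :> R.
Proof.
rewrite /normal_peak invf_le1;
  last by rewrite sqrtr_gt0 expr1n mul1r mulrn_wgt0 ?pi_gt0.
rewrite -[leLHS]sqrtr1 ler_wsqrtr// expr1n mul1r.
by have := pi_ge2 R; rewrite mulr2n; lra.
Qed.

Lemma is_derive_normal_pdf x : is_derive x (1 : R) phi (- (x * phi x)).
Proof.
have -> : phi = (fun y => normal_peak 1 * expR (- (y ^+ 2 / 2))).
  by apply/funext => y; exact: normal_pdf01E.
apply: is_derive_eq.
rewrite /GRing.scale/=; lra.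
Qed.

Lemma normal_pdf01_ge0 x : 0 <= phi x.
Proof. exact: normal_pdf_ge0. Qed.

(** The Gaussian factor is the square of exp(-u) with u = x^2/4, and (1 + u) exp(-u) <= 1. *)
Lemma normal_pdf01_decay x : (1 + x ^+ 2 / 4) ^+ 2 * phi x <= 1.
Proof.
have -> : phi x = normal_peak 1 * (expR (- (x ^+ 2 / 4))) ^+ 2.
  rewrite normal_pdf01E -expRM_natl; congr (_ * expR _); lra.
set e := expR _.
have e0 : 0 <= e by exact: expR_ge0.
have x2 : 0 <= x ^+ 2 by exact: sqr_ge0.
have ub : (1 + x ^+ 2 / 4) * e <= 1.
  rewrite /e expRN ler_pdivrMr ?expR_gt0// mul1r expR_ge1Dx.
  by [].
have ge : 0 <= (1 + x ^+ 2 / 4) * e by rewrite mulr_ge0// addr_ge0// divr_ge0.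
rewrite mulrCA -exprMn -[leRHS]mul1r ler_pM ?normal_peak1_le1 ?normal_peak_ge0
  ?exprn_ge0//.
by rewrite exprn_ile1.
Qed.

(** The constant comes from 16 (1 + x^2/4)^2 = 16 + 8 x^2 + x^4, which dominates every |x|^k with k
    <= 4. *)
Lemma normal_pdf01_moment x (k : nat) : (k <= 4)%N ->
  `|x| ^+ k * phi x <= 16.
Proof.
move=> k4; apply: le_trans (_ : 16 * ((1 + x ^+ 2 / 4) ^+ 2 * phi x) <= _);
  last first.
  by have := normal_pdf01_decay x; lra.
rewrite mulrA ler_wpM2r ?normal_pdf01_ge0//.
rewrite -(real_normK (num_real x)); have := normr_ge0 x; set z := `|x| => z0.
have z2 : 0 <= z ^+ 2 by exact: exprn_ge0.
have z4 : 0 <= z ^+ 4 by exact: exprn_ge0.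
have -> : 16 * (1 + z ^+ 2 / 4) ^+ 2 = 16 + 8 * z ^+ 2 + z ^+ 4 by lra.
case: k k4 => [|[|[|[|[|//]]]]] _; rewrite ?expr0 ?expr1; try lra.
- by have := sqr_ge0 (z - 1); rewrite sqrrB; lra.
- have : 0 <= z ^+ 2 * (z - 1) ^+ 2 by rewrite mulr_ge0// sqr_ge0.
  have -> : z ^+ 2 * (z - 1) ^+ 2 = z ^+ 4 - 2 * z ^+ 3 + z ^+ 2 by ring.
  lra.
Qed.

(** As a random variable under the normal law, the identity has [normal_cdf] as distribution
    function; the limits of a cdf at infinity then give the tails. *)
Let idTR : measurableTypeR R -> R := idfun.

#[local] HB.instance Definition _ :=
  @isMeasurableFun.Build _ _ _ _ idTR (@measurable_id _ _ setT).

Lemma normal_cdf_tail (e : R) : 0 < e ->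
  exists2 K, 0 < K & normal_cdf (- K) <= e /\ 1 - e <= normal_cdf K.
Proof.
move=> e0; pose Z : {RV (normal_prob 0 1) >-> R} := idTR.
have cy : normal_cdf K @[K --> +oo] --> (1 : R).
  exact: (fine_cvg (cvg_cdfy1 Z)).
have cNy : normal_cdf (- K) @[K --> +oo] --> (0 : R).
  have cN : normal_cdf K @[K --> -oo] --> (0 : R).
    exact: (fine_cvg (cvg_cdfNy0 Z)).
  exact: (iffLR (cvgNy_compNP _ _) cN).
near (pinfty_nbhs R) => K; exists K; first by near: K; exact: nbhs_pinfty_gt.
split; near: K.
- move/cvgrPdist_le : cNy => /(_ _ e0); apply: filterS => K.
  by rewrite sub0r normrN ger0_norm ?normal_cdf_ge0.
- move/cvgrPdist_le : cy => /(_ _ e0); apply: filterS => K.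
  by rewrite ger0_norm ?subr_ge0 ?normal_cdf_le1// lerBlDl addrC lerBlDr addrC.
Unshelve. all: by end_near. Qed.

End standard_normal.

(** * Taylor expansions and the one-step heat estimate *)

Section normal_taylor.
Context {R : realType}.
Implicit Types (a h x : R).

Local Notation phi := (@normal_pdf R 0 1).
Local Notation Phi := (@normal_cdf R).

(** The derivative is bounded only on the side of 0 where h lies; [normal_cdf_dilation] relies on
    this, its bound being proved for t >= 0 only. *)
Lemma derive_increment_le (f df : R -> R) h B :
  (forall t, is_derive t (1 : R) f (df t)) ->
  (forall t, 0 < t * h -> `|t| <= `|h| -> `|df t| <= B) ->
  `|f h - f 0| <= B * `|h|.
Proof.
move=> fd fB.
have cf : continuous f.
  by move=> t; apply: differentiable_continuous; apply/derivable1_diffP;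
    apply: ex_derive.
have [h0|h0|<-] := ltgtP 0 h.
- have [c] := @MVT R f df 0 h h0 (fun t _ => fd t) (continuous_subspaceT cf).
  rewrite in_itv/= => /andP[c0 ch] ->; rewrite subr0 normrM ler_wpM2r//.
  by apply: fB; [rewrite mulr_gt0|rewrite !gtr0_norm// ltW].
- have [c] := @MVT R f df h 0 h0 (fun t _ => fd t) (continuous_subspaceT cf).
  rewrite in_itv/= => /andP[c0 ch]; rewrite distrC => ->.
  rewrite sub0r normrM normrN ler_wpM2r//.
  by apply: fB; [rewrite nmulr_lgt0|rewrite !ltr0_norm// lerN2 ltW].
- by rewrite subrr !normr0 mulr0.
Qed.

Let is_derive_shift (f : R -> R) a t (df : R) :
  is_derive (a + t) (1 : R) f df -> is_derive t (1 : R) (fun u => f (a + u)) df.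
Proof.
move=> fd; have dg : is_derive t (1 : R) (fun u => a + u) 1.
  have H := is_deriveD (is_derive_cst a t (1 : R)) (is_derive_id t 1).
  by apply: is_derive_eq H _; rewrite add0r.
by have := @is_derive1_comp R f (fun u => a + u) t df 1 fd dg; rewrite mulr1.
Qed.

Lemma normal_pdf_lipschitz a h : `|phi (a + h) - phi a| <= 16 * `|h|.
Proof.
have := @derive_increment_le (fun t => phi (a + t)) _ h 16 
  (fun t => is_derive_shift (is_derive_normal_pdf (a + t))).
rewrite addr0; apply => t _ _.
rewrite normrN normrM (ger0_norm (normal_pdf01_ge0 _)) -[X in X * _]expr1.
exact: normal_pdf01_moment.
Qed.

(** This is -phi', so that Phi'' = -psi. *)
Let psi x := x * phi x.

Let is_derive_psi x : is_derive x (1 : R) psi (phi x - x ^+ 2 * phi x).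
Proof.
have := @is_deriveM _ _ (fun y :
  R => y) phi x 1 1 _ (is_derive_id _ _) (is_derive_normal_pdf x).
move=> H; apply: is_derive_eq H _; rewrite /GRing.scale/=; ring.
Qed.

Let psi_lipschitz a h : `|psi (a + h) - psi a| <= 32 * `|h|.
Proof.
have := @derive_increment_le (fun t => psi (a + t)) _ h 32
  (fun t => is_derive_shift (is_derive_psi (a + t))).
rewrite addr0; apply => t _ _.
have := @normal_pdf01_moment R (a + t) 0 isT.
have := @normal_pdf01_moment R (a + t) 2 isT.
rewrite expr0 mul1r real_normK ?num_real// => H1 H2.
have := normal_pdf01_ge0 (a + t).
have : 0 <= (a + t) ^+ 2 * phi (a +
  t) by rewrite mulr_ge0 ?sqr_ge0 ?normal_pdf01_ge0.
by move=> H3 H4; rewrite ler_norml; lra.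
Qed.

Lemma normal_cdf_taylor1 a h : `|Phi (a + h) - Phi a - h * phi a| <= 16 * h ^+ 2.
Proof.
pose f t := Phi (a + t) - t * phi a.
have df t : is_derive t (1 : R) f (phi (a + t) - phi a).
  apply: is_deriveB; first exact: is_derive_shift (is_derive_normal_cdf _).
  have H := is_deriveM (is_derive_id t 1) (is_derive_cst (phi a) t (1 : R)).
  by apply: is_derive_eq H _; rewrite /GRing.scale/= mulr0 add0r mulr1.
have := derive_increment_le df (h := h) (B := 16 * `|h|).
rewrite /f addr0 mul0r subr0 -mulrA -expr2 real_normK ?num_real// => H.
have -> : Phi (a + h) - Phi a - h * phi a = Phi (a + h) - h * phi a - Phi a by ring.
apply: H => t _ th; apply: le_trans (normal_pdf_lipschitz _ _) _.
by rewrite ler_wpM2l.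
Qed.

(** Two mean value steps: the remainder has derivative g t - g 0, and g has derivative psi a - psi
    (a + t), of size at most 32 |t|. *)
Lemma normal_cdf_taylor2 a h :
  `|Phi (a + h) - Phi a - h * phi a + h ^+ 2 / 2 * (a * phi a)| <= 32 * `|h| ^+ 3.
Proof.
pose g t := phi (a + t) + t * psi a.
have dg t : is_derive t (1 : R) g (psi a - psi (a + t)).
  have H := is_deriveD (is_derive_shift (is_derive_normal_pdf (a + t)))
    (is_deriveM (is_derive_id t 1) (is_derive_cst (psi a) t (1 : R))).
  by apply: is_derive_eq H _; rewrite /GRing.scale/= mulr0 add0r mulr1 addrC.
have gB t : `|g t - g 0| <= 32 * t ^+ 2.
  have := derive_increment_le dg (h := t) (B := 32 * `|t|).
  rewrite -mulrA -expr2 real_normK ?num_real//; apply => u _ ut.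
  by rewrite distrC (le_trans (psi_lipschitz _ _))// ler_wpM2l.
pose f t := Phi (a + t) - t * phi a + t * (t * (psi a / 2)).
have df t : is_derive t (1 : R) f (g t - g 0).
  have H := is_deriveD (is_deriveB (is_derive_shift (is_derive_normal_cdf (a + t)))
    (is_deriveM (is_derive_id t 1) (is_derive_cst (phi a) t (1 : R))))
    (is_deriveM (is_derive_id t 1)
       (is_deriveM (is_derive_id t 1) (is_derive_cst (psi a / 2) t (1 : R)))).
  by apply: is_derive_eq H _; rewrite /g addr0 mulrfctE /GRing.scale/=; lra.
have := derive_increment_le df (h := h) (B := 32 * `|h| ^+ 2).
rewrite (_ : _ * `|h| = 32 * `|h| ^+ 3); last by ring.
rewrite /f addr0 !mul0r subr0 addr0 => H.
have -> : Phi (a + h) - Phi a - h * phi a + h ^+ 2 / 2 * (a * phi a) =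
  Phi (a + h) - h * phi a + h * (h * (psi a / 2)) - Phi a by rewrite /psi; lra.
apply: H => t _ th; apply: le_trans (gB _) _.
by rewrite -[t ^+ 2]real_normK ?num_real// ler_wpM2l// lerXn2r ?nnegrE.
Qed.

(** The bound is uniform in x: the second derivative in h is -(1 + h) x^3 phi((1 + h) x), and as 1 +
    h >= 1 its size is at most |y|^3 phi(y) <= 16 at y = (1 + h) x. *)
Lemma normal_cdf_dilation x h : 0 <= h ->
  `|Phi ((1 + h) * x) - Phi x - h * (x * phi x)| <= 16 * h ^+ 2.
Proof.
move=> h0.
have shift (f : R -> R) t (df : R) : is_derive ((1 + t) * x) (1 : R) f df ->
    is_derive t (1 : R) (fun u => f ((1 + u) * x)) (df * x).
  move=> fd; apply: (@is_derive1_comp R f (fun u => (1 + u) * x)) => //.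
  have H := is_deriveM (is_deriveD (is_derive_cst (1 : R) t (1 :
    R)) (is_derive_id t 1))
    (is_derive_cst x t (1 : R)).
  by apply: is_derive_eq H _; rewrite /GRing.scale/= mulr0 !add0r mulr1.
have pos t u : 0 <= u -> 0 < t * u -> 0 < t.
  by rewrite le_eqVlt => /predU1P[<-|u0]; rewrite ?mulr0 ?ltxx// pmulr_lgt0.
pose g t := x * phi ((1 + t) * x).
have dg t : is_derive t (1 : R) g (- ((1 + t) * x ^+ 3 * phi ((1 + t) * x))).
  have H := is_deriveM (is_derive_cst x t (1 :
    R)) (shift _ _ _ (is_derive_normal_pdf ((1 + t) * x))).
  by apply: is_derive_eq H _; rewrite /GRing.scale/=; ring.
have gB t : 0 <= t -> `|g t - g 0| <= 16 * t.
  move=> t0; have := derive_increment_le dg (h := t) (B := 16).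
  rewrite (ger0_norm t0); apply => u ut _.
  have u0 : 0 <= u by apply: ltW; exact: pos t0 ut.
  rewrite normrN; apply: le_trans (@normal_pdf01_moment R ((1 + u) * x) 3 isT).
  rewrite normrM (ger0_norm (normal_pdf01_ge0 _)) ler_wpM2r ?normal_pdf01_ge0//.
  rewrite normrM normrX normrM exprMn ler_wpM2r ?exprn_ge0//.
  by rewrite ger0_norm ?addr_ge0// ler_eXnr// lerDl.
pose f t := Phi ((1 + t) * x) - t * (x * phi x).
have df t : is_derive t (1 : R) f (g t - g 0).
  have H := is_deriveB (shift _ _ _ (is_derive_normal_cdf ((1 + t) * x)))
    (is_deriveM (is_derive_id t 1) (is_derive_cst (x * phi x) t (1 : R))).
  by apply: is_derive_eq H _; rewrite /g /GRing.scale/= addr0 mul1r; ring.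
have := derive_increment_le df (h := h) (B := 16 * h).
rewrite /f addr0 mul1r mul0r subr0 (ger0_norm h0) -mulrA -expr2 => H.
have -> : Phi ((1 + h) * x) - Phi x - h * (x * phi x) =
  Phi ((1 + h) * x) - h * (x * phi x) - Phi x by ring.
apply: H => t th tle.
have t0 : 0 <= t by apply: ltW; exact: pos h0 th.
by apply: le_trans (gB _ t0) _; rewrite ler_wpM2l// -(ger0_norm t0).
Qed.

(** This is [heat_step] after division by sqrt t, with 1 + h = (1 - u^2)^(-1/2) for the change of
    variance. The first order cancels because p u = e, the second because h = u^2/2 + O(u^4)
    balances Phi'' = -psi. *)
Let heat_step_normalized x e u p h : 0 <= p <= 1 -> p * u = e -> 0 <= u ->
  u ^+ 2 <= 1 / 2 -> 0 <= h -> (1 + h) ^+ 2 * (1 - u ^+ 2) = 1 ->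
  `|(1 - p) * Phi (x + e) + p * Phi ((1 + h) * (x + e - u)) - Phi x| <=
  112 * (e ^+ 2 + p * u ^+ 3).
Proof.
move=> /andP[p0 p1] pu u0 u2 h0 hE.
set x1 := x + e; set x2 := x1 - u.
have u1 : u <= 1.
  by rewrite leNgt; apply/negP => u1; have := mulr_egt1 u1 u1; rewrite -expr2; lra.
have u2_0 : 0 <= u ^+ 2 by exact: exprn_ge0.
have u3_0 : 0 <= u ^+ 3 by exact: exprn_ge0.
have u4_0 : 0 <= u ^+ 4 by exact: exprn_ge0.
have u43 : u ^+ 4 <= u ^+ 3 by rewrite exprSr ler_piMr.
have hh : 2 * h + h ^+ 2 = u ^+ 2 * (1 + h) ^+ 2.
  by move: hE; rewrite mulrBr mulr1 => hE; rewrite [RHS]mulrC; lra.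
have h2_0 : 0 <= h ^+ 2 by exact: exprn_ge0.
have hlam : (1 + h) ^+ 2 <= 2.
  have : (1 + h) ^+ 2 * (1 / 2) <= (1 + h) ^+ 2 * (1 - u ^+ 2).
    by rewrite ler_wpM2l ?sqr_ge0//; lra.
  by rewrite hE; lra.
have hu : h <= u ^+ 2.
  have : u ^+ 2 * (1 + h) ^+ 2 <= u ^+ 2 * 2 by rewrite ler_wpM2l.
  lra.
have h2u : h ^+ 2 <= u ^+ 4.
  by rewrite (_ : u ^+ 4 = (u ^+ 2) ^+ 2); [rewrite lerXn2r ?nnegrE|ring].
have r6 : `|h - u ^+ 2 / 2| <= 2 * u ^+ 4.
  have -> : h - u ^+ 2 / 2 = u ^+ 2 * ((1 + h) ^+ 2 - 1) / 2 - h ^+ 2 / 2 by lra.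
  have H1 : u ^+ 2 * ((1 + h) ^+ 2 - 1) <= 3 * u ^+ 4.
    rewrite (_ : u ^+ 4 = u ^+ 2 * u ^+ 2); last by ring.
    rewrite mulrCA ler_wpM2l//.
    have : h * h <= h * u ^+ 2 by rewrite ler_wpM2l.
    have : h * u ^+ 2 <= (1 / 2) * u ^+ 2 by rewrite ler_wpM2r//; lra.
    have -> : (1 + h) ^+ 2 - 1 = 2 * h + h * h by ring.
    lra.
  have H2 : 0 <= u ^+ 2 * ((1 + h) ^+ 2 - 1).
    rewrite mulr_ge0// (_ : (1 + h) ^+ 2 - 1 = 2 * h + h ^+ 2); last by ring.
    lra.
  by rewrite ler_norml; lra.
have := normal_cdf_taylor1 x e; rewrite -/x1; set r1 := _ - _ => r1B.
have := normal_cdf_dilation x2 h0; set r2 := _ - h * _ => r2B.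
have := normal_cdf_taylor2 x1 (- u); rewrite -/x2 normrN (ger0_norm u0) sqrrN.
set r3 := _ + _ / 2 * _ => r3B.
have := psi_lipschitz x1 (- u); rewrite -/x2 normrN (ger0_norm u0).
set r4 := _ - _ => r4B.
have := normal_pdf_lipschitz x e; rewrite -/x1; set r5 := _ - _ => r5B.
have psi1 : `|psi x1| <= 16.
  rewrite normrM (ger0_norm (normal_pdf01_ge0 _)) -[X in X * _]expr1.
  exact: normal_pdf01_moment.
(* The term e r5 moves phi from x to x1, where e phi x1 cancels the linear term p u phi x1 of the
   jump. The bracket after p costs 32 + 32 + 16 + 32 = 112 times u^3, while the terms in e^2 need
   only 32. *)
have -> : (1 - p) * Phi x1 + p * Phi ((1 + h) * x2) - Phi x =
    r1 - e * r5 + p * ((h - u ^+ 2 / 2) * psi x1 + h * r4 + r2 + r3).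
  rewrite /r1 /r5 /r4 /r2 /r3 /psi -pu; by field.
have e0 : 0 <= e by rewrite -pu mulr_ge0.
have B5 : `|e * r5| <= 16 * e ^+ 2.
  rewrite normrM (ger0_norm e0) expr2 mulrCA ler_wpM2l//.
  by rewrite -[X in 16 * X]ger0_norm.
have B6 : `|(h - u ^+ 2 / 2) * psi x1| <= 2 * u ^+ 4 * 16 by rewrite normrM ler_pM.
have B4 : `|h * r4| <= u ^+ 2 * (32 * u) by rewrite normrM (ger0_norm h0) ler_pM.
have BZ : `|(h - u ^+ 2 / 2) * psi x1 + h * r4 + r2 + r3| <= 112 * u ^+ 3.
  have -> : 112 * u ^+ 3 = 32 * u ^+ 3 + u ^+ 2 * (32 * u) + 16 * u ^+ 3 + 32 *
    u ^+ 3 by ring.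
  have {}r2B : `|r2| <= 16 * u ^+ 3 by apply: le_trans r2B _; lra.
  have {}B6 : `|(h - u ^+ 2 / 2) * psi x1| <= 32 * u ^+ 3.
    by apply: le_trans B6 _; lra.
  by do 3 (apply: le_trans (ler_normD _ _) _; apply: lerD => //).
have BpZ : `|p * ((h - u ^+ 2 / 2) * psi x1 + h * r4 + r2 + r3)| <= p * (112 *
  u ^+ 3).
  by rewrite normrM (ger0_norm p0) ler_wpM2l.
have -> : 112 * (e ^+ 2 + p * u ^+ 3) = 96 * e ^+ 2 + 16 * e ^+ 2 + p * (112 *
  u ^+ 3) by ring.
apply: le_trans (ler_normD _ _) _; apply: lerD => //.
apply: le_trans (ler_normB _ _) _; apply: lerD => //.
by apply: le_trans r1B _; have := sqr_ge0 e; lra.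
Qed.

(* [Phi (y / sqrt t)] solves the heat equation, so its mean is almost preserved
   when [y] increases by [e] and, with probability [p], drops by [s] while [t]
   drops by [s ^+ 2]. *)
Lemma heat_step (y t s e p : R) : 0 <= p <= 1 -> p * s = e -> 0 <= s ->
  0 < t -> s ^+ 2 <= t / 2 ->
  `|(1 - p) * Phi ((y + e) / Num.sqrt t) +
    p * Phi ((y + e - s) / Num.sqrt (t - s ^+ 2)) - Phi (y / Num.sqrt t)| <=
  112 * (e ^+ 2 / t + p * (s / Num.sqrt t) ^+ 3).
Proof.
move=> p01 ps s0 t0 st.
have ts0 : 0 < t - s ^+ 2 by lra.
set q := Num.sqrt t; set q' := Num.sqrt (t - s ^+ 2).
have q0 : 0 < q by rewrite sqrtr_gt0.
have q'0 : 0 < q' by rewrite sqrtr_gt0.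
have q2 : q ^+ 2 = t by rewrite sqr_sqrtr ?ltW.
have q'2 : q' ^+ 2 = t - s ^+ 2 by rewrite sqr_sqrtr ?ltW.
have := @heat_step_normalized (y / q) (e / q) (s / q) p (q / q' - 1) p01.
have -> : (1 + (q / q' - 1)) * (y / q + e / q - s / q) = (y + e - s) / q'.
  by field; rewrite !lt0r_neq0.
rewrite -mulrDl [(e / q) ^+ 2]expr_div_n q2; apply.
- by rewrite mulrA ps.
- by rewrite divr_ge0// ltW.
- by rewrite expr_div_n q2 ler_pdivrMr//; lra.
- by rewrite subr_ge0 ler_pdivlMr// mul1r ler_wsqrtr// gerBl sqr_ge0.
- rewrite addrC subrK expr_div_n q2 q'2 expr_div_n q2; field.
  by rewrite !lt0r_neq0.
Qed.

End normal_taylor.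

(** * The Markov chain of accepted counts *)

Section rank_sums.
Context {R : realType}.
Variable r : nat -> nat.
Hypothesis rP : rank_sequence r.

(** Starting at k = 0 and stopping before m makes a step out of state m add exactly 1/r(m). Compared
    with a sum over 1 <= k <= m, there is the extra term 1/r(0) = 1 and the last term is missing. *)
Definition rank_sum (m : nat) : R := \sum_(k < m) (r k)%:R^-1.
Definition rank_sum2 (m : nat) : R := \sum_(k < m) (r k)%:R ^- 2.

Lemma rank_sumS m : rank_sum m.+1 = rank_sum m + (r m)%:R^-1.
Proof. exact: big_ord_recr. Qed.

Lemma rank_sum2S m : rank_sum2 m.+1 = rank_sum2 m + (r m)%:R ^- 2.
Proof. exact: big_ord_recr. Qed.

Lemma rank_ge1 m : (1 : R) <= (r m)%:R.
Proof. by rewrite ler1n rank_sequence_gt0. Qed.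

Lemma rank_gt0 m : (0 : R) < (r m)%:R.
Proof. by rewrite ltr0n rank_sequence_gt0. Qed.

Lemma rank_inv2_le m : (r m)%:R ^- 2 <= (r m)%:R^-1 :> R.
Proof.
by rewrite lef_pV2 ?posrE ?exprn_gt0 ?rank_gt0// ler_eXnr ?rank_ge1.
Qed.

Lemma le_rank_sum2 m n : (m <= n)%N -> rank_sum2 m <= rank_sum2 n.
Proof.
move=> /subnK <-; elim: (n - m)%N => [//|k IH]; apply: le_trans IH _.
by rewrite addSn rank_sum2S lerDl invr_ge0 exprn_ge0.
Qed.

Lemma rank_sum2_incr_le m n : (m <= n)%N ->
  rank_sum2 n - rank_sum2 m <= rank_sum n - rank_sum m.
Proof.
move=> /subnK <-; elim: (n - m)%N => [|k IH]; first by rewrite !subrr.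
rewrite addSn rank_sum2S rank_sumS; have := rank_inv2_le (k + m); lra.
Qed.

End rank_sums.

(** Telescoping majorant of the sum of 1/(j+1)^2; the factor 2 comes from x + 1 <= 2 x for x >=
    1. *)
Lemma harmonic_gap_le (R : realFieldType) (j : nat) :
  j.+1%:R^-1 ^+ 2 <= 2 / j.+1%:R - 2 / j.+2%:R :> R.
Proof.
have x1 : (1 : R) <= j.+1%:R by rewrite ler1n.
rewrite -[j.+2]addn1 natrD; set x := j.+1%:R in x1 *.
have x0 : 0 < x by rewrite (lt_le_trans _ x1).
have -> : 2 / x - 2 / (x + 1) = 2 / (x * (x + 1)).
  by field; rewrite !lt0r_neq0// addr_gt0.
rewrite exprVn ler_pdivlMr ?mulr_gt0 ?addr_gt0// mulrC ler_pdivrMr ?exprn_gt0//.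
have : x * 1 <= x * x by rewrite ler_wpM2l// ltW.
by rewrite expr2; lra.
Qed.

(** [A0], [A1], [A2] are a profile and [d0], [d1], [d2] its defect at a state and after a rejection
    or an acceptance; [Z] is the actual value after an acceptance, which is redefined once [ms] is
    reached. *)
Lemma convex_step_le (R : realFieldType) (p A0 A1 A2 d0 d1 d2 Z : R) : 0 <= p ->
  (1 - p) * A1 + p * A2 - A0 <= d0 - ((1 - p) * d1 + p * d2) ->
  Z <= A2 + d2 -> (1 - p) * (A1 + d1) + p * Z <= A0 + d0.
Proof. by move=> p0 h1 /(ler_wpM2l p0); lra. Qed.

(** * Supersolutions for the chain *)

Section chain.
Context {R : realType}.
Variable r : nat -> nat.
Hypothesis rP : rank_sequence r.
Local Notation Phi := (@normal_cdf R).
Local Notation g := (@rank_sum R r).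
Local Notation V := (@rank_sum2 R r).
Local Notation H n := (series (@harmonic R) n).

(* [mu n m] is the mass of the state [m] at time [n], on some event of the past
   of time [k]. *)
Variables (mu : nat -> nat -> R) (k : nat).
Hypothesis mu_ge0 : forall n m, 0 <= mu n m.
Hypothesis muS : forall n (W : nat -> R), (k <= n)%N ->
  \sum_(m < n.+2) mu n.+1 m * W m =
  \sum_(m < n.+1) mu n m *
     ((1 - (r m)%:R / n.+1%:R) * W m + (r m)%:R / n.+1%:R * W m.+1).

Lemma supersolution_le (U : nat -> nat -> R) n : (k <= n)%N ->
  (forall j m, (k <= j < n)%N -> (m <= j)%N ->
    (1 - (r m)%:R / j.+1%:R) * U j.+1 m + (r m)%:R / j.+1%:R * U j.+1 m.+1
      <= U j m) ->
  \sum_(m < n.+1) mu n m * U n m <= \sum_(m < k.+1) mu k m * U k m.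
Proof.
move=> kn UP.
suff IH i : (k <= i <= n)%N -> \sum_(m < i.+1) mu i m * U i m <=
    \sum_(m < k.+1) mu k m * U k m by apply: IH; rewrite kn leqnn.
elim: i => [|j IH]; first by rewrite leqn0 => /andP[/eqP <-].
move=> /andP[]; rewrite leq_eqVlt => /predU1P[-> //|]; rewrite ltnS => kj jn.
rewrite muS//; apply: le_trans (IH _); last by rewrite kj ltnW.
by apply: ler_sum => m _; rewrite ler_wpM2l// UP ?kj// -ltnS.
Qed.

Variables (n ms : nat) (t0 K : R).
Hypothesis kn : (k <= n)%N.
Hypothesis t0_ge2 : 2 <= t0.
Hypothesis K_gt0 : 0 < K.
Hypothesis Kt0 : K <= 2 * Num.sqrt t0.

(* [profile + defect] is a supersolution of the chain up to the hitting time of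
   [ms]: [defect] decreases by at least the one-step error of [profile]. *)
Definition profile (a : R) (j m : nat) : R :=
  Phi ((g ms - g m + H j - a) / Num.sqrt (V ms - V m + t0)).

Definition defect (j m : nat) : R :=
  112 * (2 / j.+1%:R / t0 + (V ms - V m) / Num.sqrt t0 ^+ 3).

Let t0_gt0 : 0 < t0. Proof. by rewrite (lt_le_trans _ t0_ge2). Qed.
Let st0 : 0 < Num.sqrt t0. Proof. by rewrite sqrtr_gt0. Qed.

Lemma defect_ge0 j m : (m <= ms)%N -> 0 <= defect j m.
Proof.
by move=> ?; rewrite mulr_ge0// addr_ge0// divr_ge0 ?subr_ge0 ?le_rank_sum2
  ?exprn_ge0 ?ltW.
Qed.

(** With p = r(m)/(j+1) and s = 1/r(m), p s is the increment of H, as [heat_step] requires. The term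
    2/(j+1) of [defect] pays for (p s)^2 and its V term for p s^3, since s <= 1 and the variance is
    at least t0. *)
Lemma profile_step a j m : (m <= j)%N -> (m < ms)%N ->
  `|(1 - (r m)%:R / j.+1%:R) * profile a j.+1 m
    + (r m)%:R / j.+1%:R * profile a j.+1 m.+1 - profile a j m|
  <= defect j m - ((1 - (r m)%:R / j.+1%:R) * defect j.+1 m
                    + (r m)%:R / j.+1%:R * defect j.+1 m.+1).
Proof.
move=> mj mms; set p := (r m)%:R / j.+1%:R; set s : R := (r m)%:R^-1.
have r0 := @rank_gt0 R _ rP m.
have p01 : 0 <= p <= 1.
  rewrite divr_ge0//= ler_pdivrMr// mul1r ler_nat.
  by rewrite (leq_trans (rank_sequence_le m rP)).
have s0 : 0 <= s by rewrite invr_ge0 ltW.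
have s1 : s <= 1 by rewrite invf_le1// rank_ge1.
have s2 : s ^+ 2 <= 1 by rewrite exprn_ile1.
set t := V ms - V m + t0.
have t0t : t0 <= t by rewrite lerDr subr_ge0 le_rank_sum2// ltnW.
have ps : p * s = j.+1%:R^-1 by rewrite /p /s mulrAC mulfV ?mul1r// lt0r_neq0.
have t_gt0 : 0 < t := lt_le_trans t0_gt0 t0t.
have := heat_step (g ms - g m + H j - a) p01 ps s0 t_gt0 _.
have st : s ^+ 2 <= t / 2.
  by rewrite (le_trans s2)// ler_pdivlMr// mul1r (le_trans t0_ge2).
move=> /(_ st).
have HS : H j.+1 = H j + j.+1%:R^-1 by rewrite seriesSr.
have -> : g ms - g m + H j - a + j.+1%:R^-1 = g ms - g m + H j.+1 - a.
  by rewrite HS -!addrA [j.+1%:R^-1 + _]addrC.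
have -> : g ms - g m + H j.+1 - a - s = g ms - g m.+1 + H j.+1 - a.
  by rewrite rank_sumS -/s opprD !addrA [LHS]addrAC [in LHS](addrAC _ _ (- s)).
have -> : t - s ^+ 2 = V ms - V m.+1 + t0.
  by rewrite /t rank_sum2S /s exprVn opprD addrA [LHS]addrAC.
move=> /le_trans; apply.
have -> : defect j m - ((1 - p) * defect j.+1 m + p * defect j.+1 m.+1) =
   112 * ((2 / j.+1%:R - 2 / j.+2%:R) / t0 + p * (s ^+ 2 / Num.sqrt t0 ^+ 3)).
  rewrite /defect rank_sum2S -exprVn -/s; ring.
rewrite ler_wpM2l// lerD//.
  rewrite ler_pM ?invr_ge0 ?sqr_ge0 ?(ltW t_gt0)//; last by rewrite lef_pV2.
  exact: harmonic_gap_le.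
case/andP: p01 => p0 _;
  rewrite ler_wpM2l// expr_div_n ler_pM ?exprn_ge0 ?invr_ge0 ?exprn_ge0
    ?sqrtr_ge0//.
- by rewrite exprSr ler_piMr ?sqr_ge0.
- by rewrite lef_pV2 ?posrE ?exprn_gt0 ?sqrtr_gt0// lerXn2r ?nnegrE// ler_wsqrtr.
Qed.

(** The supersolution is killed at [ms], where it is set to 0. The shift by K sqrt t0 makes the
    profile at time n at least Phi(K) below [ms]: D = V ms - V m is at most g ms - g m, and D + K
    sqrt t0 >= K sqrt (D + t0) as soon as K <= 2 sqrt t0. *)
Lemma mass_below_le :
  Phi K * \sum_(m < n.+1 | (m < ms)%N) mu n m <=
  \sum_(m < k.+1 | (m < ms)%N) mu k m *
    (profile (H n - K * Num.sqrt t0) k m + defect k m).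
Proof.
set a := H n - _.
pose U j m := if (m < ms)%N then profile a j m + defect j m else 0.
have := @supersolution_le U n kn.
have U0 j m : (m <= ms)%N -> 0 <= profile a j m + defect j m.
  by move=> mms; rewrite addr_ge0 ?defect_ge0 ?normal_cdf_ge0.
have -> : \sum_(m < k.+1) mu k m * U k m = \sum_(m < k.+1 | (m < ms)%N) mu k m *
    (profile a k m + defect k m).
  rewrite [RHS]big_mkcond/=; apply: eq_bigr => m _.
  by rewrite /U; case: ifP; rewrite ?mulr0.
move=> sup; apply: le_trans (sup _); last first.
  move=> j m _ mj; rewrite /U; case: ltnP => mms; last first.
    by rewrite ltnNge (leq_trans mms)// !mulr0 addr0.
  have pp : 0 <= (r m)%:R / j.+1%:R :> R by rewrite divr_ge0.
  have := @profile_step a j m mj mms; rewrite ler_norml => /andP[_ step].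
  apply: convex_step_le step _ => //.
  by case: ifP => // _; exact: U0.
rewrite mulr_sumr big_mkcond/=; apply: ler_sum => m _.
rewrite /U; case: ifPn => mms; last by rewrite mulr0.
rewrite mulrC ler_wpM2l//.
apply: le_trans (_ : profile a n m <= _); last by rewrite lerDl defect_ge0// ltnW.
apply: normal_cdf_le.
have D0 : 0 <= V ms - V m by rewrite subr_ge0 le_rank_sum2// ltnW.
have VG := @rank_sum2_incr_le R _ rP _ _ (ltnW mms).
set D := V ms - V m in D0 VG *.
rewrite ler_pdivlMr ?sqrtr_gt0 ?ltr_wpDl//.
have -> : g ms - g m + H n - a = g ms - g m + K * Num.sqrt t0.
  by rewrite /a opprB -addrA [H n + _]addrC subrK.
apply: le_trans (_ : D + K * Num.sqrt t0 <= _); last by rewrite lerD2r.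
have lhs0 : 0 <= K * Num.sqrt (D + t0) by rewrite mulr_ge0// ?sqrtr_ge0// ltW.
have rhs0 : 0 <= D + K * Num.sqrt t0 by rewrite addr_ge0// mulr_ge0// ltW.
rewrite -(ler_pXn2r (n := 2))// exprMn sqr_sqrtr; last by rewrite addr_ge0// ltW.
rewrite -{1}(sqr_sqrtr (ltW t0_gt0)); have Kq := Kt0; set q := Num.sqrt t0 in Kq *.
have : K * (D * K) <= K * (D * (2 *
  q)) by rewrite ler_wpM2l ?(ltW K_gt0)// ler_wpM2l.
have := sqr_ge0 D.
have -> : K ^+ 2 * (D + q ^+ 2) = K * (D * K) + (K * q) ^+ 2 by ring.
have -> : (D + K * q) ^+ 2 = D ^+ 2 + K * (D * (2 * q)) + (K * q) ^+ 2 by ring.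
lra.
Qed.

(** The complement of the profile is used below [ms] and frozen at 1 - Phi(-K) from [ms] on. At a
    crossing no later than n the profile is at most Phi(-K), because H j <= H n and the shift has
    the opposite sign. *)
Lemma mass_above_le :
  (1 - Phi (- K)) * \sum_(m < n.+1 | (ms <= m)%N) mu n m <=
  \sum_(m < k.+1) mu k m *
    (if (m < ms)%N then 1 - profile (H n + K * Num.sqrt t0) k m + defect k m
     else 1 - Phi (- K)).
Proof.
set a := H n + _.
pose U j m := if (m < ms)%N then 1 - profile a j m + defect j m else 1 - Phi (- K).
have HU : {homo series (@harmonic R) : i j / (i <= j)%N >-> i <= j}.
  by apply/nondecreasing_seqP => i; rewrite seriesSr lerDl /harmonic/= invr_ge0.
have flip (p A0 A1 A2 B : R) : - B <= (1 - p) * A1 + p * A2 - A0 ->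
    (1 - p) * (1 - A1) + p * (1 - A2) - (1 - A0) <= B by lra.
have Ums j : (j <= n)%N -> 1 - Phi (- K) <= 1 - profile a j ms + defect j ms.
  move=> jn; apply: le_trans (_ : 1 - profile a j ms <= _);
    last by rewrite lerDl defect_ge0.
  rewrite lerD2l lerN2; apply: normal_cdf_le.
  rewrite !subrr !add0r ler_pdivrMr// /a mulNr.
  have := HU _ _ jn; lra.
have := @supersolution_le U n kn.
move=> sup; apply: le_trans (sup _); last first.
  move=> j m /andP[_ jn] mj; rewrite /U; case: ltnP => mms; last first.
    by rewrite ltnNge (leq_trans mms)//= -mulrDl subrK mul1r.
  have pp : 0 <= (r m)%:R / j.+1%:R :> R by rewrite divr_ge0.
  have := @profile_step a j m mj mms; rewrite ler_norml => /andP[step _].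
  apply: (@convex_step_le _ _ (1 - profile a j m) (1 - profile a j.+1 m)
    (1 - profile a j.+1 m.+1) (defect j m) (defect j.+1 m) (defect j.+1 m.+1))
      => //.
    exact: flip step.
  case: ifPn => // mms'.
  by rewrite (_ : m.+1 = ms) ?Ums//; apply/eqP; rewrite eqn_leq mms leqNgt.
rewrite mulr_sumr big_mkcond/=; apply: ler_sum => m _.
rewrite /U leqNgt; case: (boolP (m < ms)%N) => mms /=; last by rewrite mulrC.
rewrite mulr_ge0// addr_ge0 ?defect_ge0 ?(ltnW mms)//.
by rewrite subr_ge0 normal_cdf_le1.
Qed.

End chain.

(** S is the total mass and B the mass below the threshold; PK = Phi(K), PN = Phi(-K), q = Phi(t),
    and Pp, Pm are the values of Phi at the blurred arguments. *)
Lemma mass_squeeze (R : realFieldType) (S B q e PK PN Pp Pm : R) :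
  0 <= S -> 0 <= B -> B <= S -> 0 <= e -> 1 - e <= PK -> PN <= e ->
  Pp <= q + e -> q - e <= Pm ->
  PK * B <= S * Pp + e -> (1 - PN) * (S - B) <= S * (1 - Pm) + e ->
  `|S * q - B| <= (2 * S + 1) * e.
Proof.
move=> S0 B0 BS e0 K1 N1 pq qm up lo.
have KB : (1 - e) * B <= PK * B by rewrite ler_wpM2r.
have NB : (1 - e) * (S - B) <= (1 - PN) * (S - B).
  by rewrite ler_wpM2r ?subr_ge0// lerD2l lerN2.
have eB : e * B <= e * S by rewrite ler_wpM2l.
have eB0 : 0 <= e * B by rewrite mulr_ge0.
have SP := ler_wpM2l S0 pq.
have SN := ler_wpM2l S0 qm.
by rewrite ler_norml; lra.
Qed.

(** * The limit law of the chain *)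

Section chain_limit.
Context {R : realType}.
Variable r : nat -> nat.
Hypothesis rP : rank_sequence r.
Local Notation Phi := (@normal_cdf R).
Local Notation g := (@rank_sum R r).
Local Notation V := (@rank_sum2 R r).
Local Notation H n := (series (@harmonic R) n).

Variables (mu : nat -> nat -> R) (k : nat).
Hypothesis mu_ge0 : forall n m, 0 <= mu n m.
Hypothesis muS : forall n (W : nat -> R), (k <= n)%N ->
  \sum_(m < n.+2) mu n.+1 m * W m =
  \sum_(m < n.+1) mu n m *
     ((1 - (r m)%:R / n.+1%:R) * W m + (r m)%:R / n.+1%:R * W m.+1).

Variables (ms : nat -> nat) (sg : nat -> R) (t : R).
Hypothesis sg_y : sg n @[n --> \oo] --> +oo.
Hypothesis g_cvg : (g (ms n) - H n) / sg n @[n --> \oo] --> t.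
Hypothesis V_cvg : V (ms n) / sg n ^+ 2 @[n --> \oo] --> (1 : R).

Let S : R := \sum_(m < k.+1) mu k m.

Let sgV : (sg n)^-1 @[n --> \oo] --> (0 : R).
Proof. by apply/gtr0_cvgV0 => //; exact: (cvgry_gt sg_y). Qed.

Let sg_gt0 : \forall n \near \oo, 0 < sg n.
Proof. exact: (cvgry_gt sg_y). Qed.

Lemma total_mass n : (k <= n)%N -> \sum_(m < n.+1) mu n m = S.
Proof.
move=> /subnK <-; elim: (n - k)%N => [//|j IH].
have := @muS (j + k)%N (fun=> 1) (leq_addl _ _).
under eq_bigr do rewrite mulr1.
rewrite addSn => ->; rewrite -IH; apply: eq_bigr => m _.
by rewrite !mulr1 subrK mulr1.
Qed.

(** State m and time k stay fixed while sg grows, so g m, H k and V m drop out: this is where the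
    limit forgets the start. *)
Let profile_cvg (eta c : R) m : 0 < eta ->
  profile r (ms n) ((eta * sg n) ^+ 2) (H n + c * sg n) k m @[n --> \oo] -->
  Phi ((t - c) / Num.sqrt (1 + eta ^+ 2)).
Proof.
move=> eta0.
pose z n := (g (ms n) - g m + H k - (H n + c * sg n)) /
  Num.sqrt (V (ms n) - V m + (eta * sg n) ^+ 2).
suff cz : z n @[n --> \oo] --> (t - c) / Num.sqrt (1 + eta ^+ 2).
  exact: (cvg_comp _ _ cz (@continuous_normal_cdf R _)).
pose a n := (g (ms n) - H n) / sg n + (H k - g m) * (sg n)^-1 - c.
pose b n := V (ms n) / sg n ^+ 2 - V m * ((sg n)^-1 * (sg n)^-1) + eta ^+ 2.
have ca : a n @[n --> \oo] --> t - c.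
  have -> : t - c = t + (H k - g m) * 0 - c by rewrite mulr0 addr0.
  by apply: cvgB; [apply: cvgD => //; apply: cvgM => //|]; exact: cvg_cst.
have cb : b n @[n --> \oo] --> 1 + eta ^+ 2.
  have -> : 1 + eta ^+ 2 = 1 - V m * (0 * 0) + eta ^+ 2 by rewrite !mulr0 subr0.
  apply: cvgD; [apply: cvgB => //; apply: cvgM|]; try exact: cvg_cst.
  exact: cvgM.
have pos : 0 < 1 + eta ^+ 2 by rewrite addr_gt0// exprn_gt0.
have csb : Num.sqrt (b n) @[n --> \oo] --> Num.sqrt (1 + eta ^+ 2).
  exact: (cvg_comp _ _ cb (@sqrt_continuous R _)).
have cab : a n * (Num.sqrt (b n))^-1 @[n --> \oo] --> (t - c) / Num.sqrt (1 +
  eta ^+ 2).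
  by apply: cvgM => //; apply: cvgV => //; rewrite lt0r_neq0// sqrtr_gt0.
apply: cvg_trans cab; apply: near_eq_cvg.
near=> n.
have s0 : 0 < sg n by near: n.
rewrite /z.
have -> : V (ms n) - V m + (eta * sg n) ^+ 2 = sg n ^+ 2 * b n.
  by rewrite /b; field; rewrite lt0r_neq0.
rewrite sqrtrM ?sqr_ge0// sqrtr_sqr (ger0_norm (ltW s0)) invfM mulrA.
congr (_ / _); rewrite /a.
move: (H n) (H k) => hn hk; field; by rewrite lt0r_neq0.
Unshelve. all: by end_near. Qed.

Let defect_cvg (eta : R) m : 0 < eta ->
  defect r (ms n) ((eta * sg n) ^+ 2) k m @[n --> \oo] --> (0 : R).
Proof.
move=> eta0.
pose a n := 112 * (2 / k.+1%:R / eta ^+ 2 * ((sg n)^-1 * (sg n)^-1) +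
  (V (ms n) / sg n ^+ 2 - V m * ((sg n)^-1 * (sg n)^-1)) * (eta ^- 3 * (sg n)^-1)).
have ca : a n @[n --> \oo] --> (0 : R).
  have -> : (0 : R) = 112 * (2 / k.+1%:R / eta ^+ 2 * (0 * 0) +
     (1 - V m * (0 * 0)) * (eta ^- 3 * 0)) by rewrite !mulr0 addr0 mulr0.
  have c2 : (sg n)^-1 * (sg n)^-1 @[n --> \oo] --> (0 * 0 : R) by exact: cvgM.
  apply: cvgM; first exact: cvg_cst.
  apply: cvgD; first by apply: cvgM => //; exact: cvg_cst.
  apply: cvgM; last by apply: cvgM => //; exact: cvg_cst.
  by apply: cvgB => //; apply: cvgM => //; exact: cvg_cst.
apply: cvg_trans ca; apply: near_eq_cvg.
near=> n.
have s0 : 0 < sg n by near: n.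
rewrite /defect /a sqrtr_sqr (ger0_norm (mulr_ge0 (ltW eta0) (ltW s0))).
by field; rewrite !lt0r_neq0.
Unshelve. all: by end_near. Qed.

Let ms_gt m : \forall n \near \oo, (m < ms n)%N.
Proof.
near=> n; rewrite ltnNge; apply/negP => /(@le_rank_sum2 R r) Vm.
have s0 : 0 < sg n by near: n.
have half : 1 / 2 < V (ms n) / sg n ^+ 2.
  by near: n; move/cvgr_gt : V_cvg; apply; lra.
have big : 2 * (1 + V m) <= sg n ^+ 2.
  have V0 : 0 <= V m by rewrite sumr_ge0// => i _; rewrite invr_ge0 exprn_ge0.
  have : 2 * (1 + V m) <= sg n by near: n; exact: (cvgry_ge sg_y).
  by move=> /le_trans; apply; rewrite ler_eXnr//; near: n; exact: (cvgry_ge sg_y).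
move: half; rewrite ltr_pdivlMr ?exprn_gt0//; lra.
Unshelve. all: by end_near. Qed.

Let cvg_profile_sum (eta c : R) : 0 < eta ->
  \sum_(m < k.+1) mu k m *
    (profile r (ms n) ((eta * sg n) ^+ 2) (H n + c * sg n) k m +
     defect r (ms n) ((eta * sg n) ^+ 2) k m) @[n --> \oo] -->
  S * Phi ((t - c) / Num.sqrt (1 + eta ^+ 2)).
Proof.
move=> eta0; rewrite /S mulr_suml.
apply: cvg_big => [|m _]; first exact: add_continuous.
 apply: cvgM; first exact: cvg_cst.
rewrite -[X in _ --> X]addr0.
by apply: cvgD; [exact: profile_cvg|exact: defect_cvg].
Qed.

Let cvg_profile_sumN (eta c : R) : 0 < eta ->
  \sum_(m < k.+1) mu k m *
    (1 - profile r (ms n) ((eta * sg n) ^+ 2) (H n + c * sg n) k m +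
     defect r (ms n) ((eta * sg n) ^+ 2) k m) @[n --> \oo] -->
  S * (1 - Phi ((t - c) / Num.sqrt (1 + eta ^+ 2))).
Proof.
move=> eta0; rewrite /S mulr_suml.
apply: cvg_big => [|m _]; first exact: add_continuous.
 apply: cvgM; first exact: cvg_cst.
rewrite -[X in _ --> X]addr0.
apply: cvgD; last exact: defect_cvg.
by apply: cvgB; [exact: cvg_cst|exact: profile_cvg].
Qed.

(** The parameters are fixed in the order K, eta, n: K makes both tails of Phi small, eta brings the
    arguments (t + K eta) / sqrt (1 + eta^2) and (t - K eta) / sqrt (1 + eta^2) close to t, and n
    brings the sums at time k close to their limits. *)
Lemma chain_clt :
  \sum_(m < n.+1 | (m < ms n)%N) mu n m @[n --> \oo] --> S * Phi t.
Proof.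
apply/cvgrPdist_le => e e0.
have S0 : 0 <= S by exact: sumr_ge0.
pose e1 := e / (2 * S + 1).
have den : 0 < 2 * S + 1 by rewrite ltr_wpDl// mulr_ge0.
have e10 : 0 < e1 by rewrite divr_gt0.
have [K K0 [KN KP]] := normal_cdf_tail e10.
have arg c : (t + c * eta) / Num.sqrt (1 + eta ^+ 2) @[eta --> 0^'+] --> t.
  have E : t = (t + c * 0) / Num.sqrt (1 + (0 : R) ^+ 2).
    by rewrite mulr0 addr0 expr0n addr0 sqrtr1 divr1.
  rewrite [X in _ --> X]E; apply: cvg_at_right_filter.
  apply: cvgM.
    by apply: cvgD; [exact: cvg_cst|apply: cvgM; [exact: cvg_cst|exact: cvg_id]].
  apply: cvgV; first by rewrite expr0n addr0 sqrtr1 oner_neq0.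
  have c1 : 1 + eta ^+ 2 @[eta --> (0 : R)] --> 1 + (0 : R) ^+ 2.
    by apply: cvgD; [exact: cvg_cst|exact: exprn_continuous].
  exact: (cvg_comp _ _ c1 (@sqrt_continuous R _)).
have [eta eta0 [etaP etaN]] : exists2 eta : R, 0 < eta &
    Phi ((t + K * eta) / Num.sqrt (1 + eta ^+ 2)) <= Phi t + e1 /\
    Phi t - e1 <= Phi ((t + (- K) * eta) / Num.sqrt (1 + eta ^+ 2)).
  have close c : \forall eta \near (0 : R)^'+,
      `|Phi t - Phi ((t + c * eta) / Num.sqrt (1 + eta ^+ 2))| <= e1.
    have cP := cvg_comp _ _ (arg c) (@continuous_normal_cdf R t).
    by move/cvgrPdist_le : cP; apply.
  have closeK := close K; have closeN := close (- K).
  near (0 : R)^'+ => eta; exists eta; first by near: eta; exact: nbhs_right_gt.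
  split.
    have : `|Phi t - Phi ((t + K * eta) / Num.sqrt (1 + eta ^+ 2))| <= e1.
      by near: eta; exact: closeK.
    by rewrite ler_norml; lra.
  have : `|Phi t - Phi ((t + (- K) * eta) / Num.sqrt (1 + eta ^+ 2))| <= e1.
    by near: eta; exact: closeN.
  by rewrite ler_norml; lra.
have cvgP := @cvg_profile_sum eta (- (K * eta)) eta0.
have cvgN := @cvg_profile_sumN eta (K * eta) eta0.
rewrite opprK in cvgP; rewrite -mulNr in cvgN.
near=> n.
have s0 : 0 < sg n by near: n.
have kn : (k <= n)%N by near: n; exact: nbhs_infty_ge.
have msk : (k < ms n)%N by near: n; exact: ms_gt.
have stE : Num.sqrt ((eta * sg n) ^+ 2) = eta * sg n.
  by rewrite sqrtr_sqr ger0_norm// mulr_ge0// ltW.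
(* This one bound gives both t0 >= 2 and K <= 2 sqrt t0. *)
have big : K + 2 <= eta * sg n.
  by rewrite mulrC -ler_pdivrMr//; near: n; exact: (cvgry_ge sg_y).
have t02 : 2 <= (eta * sg n) ^+ 2.
  have : 1 * (eta * sg n) <= (eta * sg n) * (eta * sg n).
    by rewrite ler_wpM2r//; lra.
  rewrite expr2; lra.
have Kt0 : K <= 2 * Num.sqrt ((eta * sg n) ^+ 2) by rewrite stE; lra.
set B := \sum_(m < n.+1 | (m < ms n)%N) mu n m.
have BS : B + \sum_(m < n.+1 | (ms n <= m)%N) mu n m = S.
  rewrite -(total_mass kn) [RHS](bigID (fun m : 'I_n.+1 => (m < ms n)%N))/=.
  by congr (_ + _); apply: eq_bigl => m; rewrite leqNgt.
have B0 : 0 <= B by apply: sumr_ge0.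
have A0 : 0 <= \sum_(m < n.+1 | (ms n <= m)%N) mu n m by apply: sumr_ge0.
have up : Phi K * B <= S * Phi ((t + K * eta) / Num.sqrt (1 + eta ^+ 2)) + e1.
  apply: le_trans (mass_below_le rP mu_ge0 muS (ms n) kn t02 K0 Kt0) _.
  rewrite stE -[H n - _](_ : H n + (- (K * eta)) * sg n = _);
    last by rewrite mulNr mulrA.
  rewrite [leLHS](_ : _ = \sum_(m < k.+1) mu k m *
    (profile r (ms n) ((eta * sg n) ^+ 2) (H n + (- (K * eta)) * sg n) k m +
     defect r (ms n) ((eta * sg n) ^+ 2) k m)); last first.
    by apply: eq_bigl => m; rewrite (leq_trans _ msk)// ltn_ord.
  near: n; move/cvgrPdist_le : cvgP => /(_ e1 e10); apply: filterS => n.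
  by rewrite ler_norml; lra.
have lo : (1 - Phi (- K)) * (S - B) <=
    S * (1 - Phi ((t + (- K) * eta) / Num.sqrt (1 + eta ^+ 2))) + e1.
  have -> : S - B = \sum_(m < n.+1 | (ms n <= m)%N) mu n m by rewrite -BS
    addrAC subrr add0r.
  apply: le_trans (mass_above_le rP mu_ge0 muS (ms n) K kn t02) _.
  rewrite stE -[H n + _](_ : H n + K * eta * sg n = _); last by rewrite mulrA.
  rewrite [leLHS](_ : _ = \sum_(m < k.+1) mu k m *
    (1 - profile r (ms n) ((eta * sg n) ^+ 2) (H n + K * eta * sg n) k m +
     defect r (ms n) ((eta * sg n) ^+ 2) k m)); last first.
    by apply: eq_bigr => m _; rewrite (leq_trans _ msk)// ltn_ord.
  near: n; move/cvgrPdist_le : cvgN => /(_ e1 e10); apply: filterS => n.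
  by rewrite ler_norml; lra.
have eE : (2 * S + 1) * e1 = e by rewrite mulrC divfK// lt0r_neq0.
rewrite -eE; apply: (mass_squeeze _ _ _ _ KP KN etaP etaN up lo) => //.
- by rewrite -BS lerDl.
- exact: ltW.
Unshelve. all: by end_near. Qed.

End chain_limit.

(** * Asymptotics of the rank sequence *)

Section rank_asymptotics.
Context {R : realType}.
Variable r : nat -> nat.
Hypothesis rP : rank_sequence r.
Hypothesis rRV : regularly_varying (fun m => (r m)%:R : R).
Local Notation V := (@rank_sum2 R r).

Let r_gt0 m : (0 : R) < (r m)%:R := rank_gt0 rP m.

Let le_r m n : (m <= n)%N -> (r m)%:R <= (r n)%:R :> R.
Proof. by move=> mn; rewrite ler_nat rank_sequence_mono. Qed.

(* If [r] grew by a factor [1 + e] on every step from [m] to [(1 + 1/j) m], then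
   [j] such steps would multiply it by more than the limit of [r (e m) / r m]. *)
Lemma rank_slow_variation (e : R) : 0 < e ->
  exists2 kappa : R, 0 < kappa &
  \forall m0 \near \oo, forall m m', (m0 <= m <= m')%N ->
    m'%:R <= (1 + kappa) * m%:R :> R -> (r m')%:R <= (1 + e) * (r m)%:R :> R.
Proof.
move=> e0; have [_ rv] := rRV.
have [E E0 rE] := rv (expR 1) (expR_gt0 1).
(* By Bernoulli (1 + e/2)^j >= 1 + j e/2 > E + 1, whereas (1 + 1/j)^j <= exp(1) keeps j iterates of
   n -> floor(l n), started at m, below exp(1) m. *)
pose j := (Num.truncn ((E + 1) / (e / 2))).+1.
have jE : (E + 1) / (e / 2) < j%:R by exact: truncnS_gt.
have j0 : (0 : R) < j%:R by [].
pose l : R := 1 + j%:R^-1.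
have l1 : 1 < l by rewrite ltrDl invr_gt0.
have l0 : 0 < l by rewrite (lt_trans _ l1).
have [L L0 rL] := rv l l0.
exists j%:R^-1; first by rewrite invr_gt0.
have [Le|eL] := ltP L (1 + e).
  have : \forall m \near \oo, (r (Num.truncn (l * m%:R)))%:R / (r m)%:R < 1 + e.
    by move/cvgr_lt : rL; apply.
  move=> [m0 _ m0P]; exists m0 => // m1 /= m01 m m' /andP[m1m mm'] m'l.
  apply: le_trans (_ : (r (Num.truncn (l * m%:R)))%:R <= _).
    by apply: le_r; rewrite truncn_ge_nat// mulr_ge0// ltW.
  by rewrite -ler_pdivrMr// ltW// m0P//= (leq_trans m01).
exfalso.
have [m0 _ m0P] : \forall m \near \oo, 1 + e / 2 < (r (Num.truncn (l *
  m%:R)))%:R / (r m)%:R.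
  by move/cvgr_gt : rL; apply; rewrite (lt_le_trans _ eL)//; lra.
have [m1 _ m1P] : \forall m \near \oo, (r (Num.truncn (expR 1 * m%:R :
  R)))%:R / (r m)%:R < E + 1.
  by move/cvgr_lt : rE; apply; lra.
pose m := maxn m0 m1.
pose f n := Num.truncn (l * n%:R).
have fge n : (n <= f n)%N.
  by rewrite truncn_ge_nat ?mulr_ge0 ?(ltW l0)// ler_peMl// ltW.
have iterP i : [/\ (m <= iter i f m)%N, (iter i f m)%:R <= l ^+ i * m%:R &
    (1 + e / 2) ^+ i * (r m)%:R <= (r (iter i f m))%:R].
  elim: i => [|i [mi li ri]]; first by rewrite !expr0 !mul1r.
  split => /=; first exact: leq_trans (fge _).
    rewrite exprS -mulrA; apply: le_trans (_ : l * (iter i f m)%:R <= _).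
      by rewrite truncn_le mulr_ge0// ltW.
    by rewrite ler_wpM2l// ltW.
  rewrite exprS -mulrA;
    apply: le_trans (_ : (1 + e / 2) * (r (iter i f m))%:R <= _).
    by rewrite ler_wpM2l//; lra.
  rewrite -ler_pdivlMr// ltW// m0P//=.
  by rewrite (leq_trans _ mi)// leq_maxl.
have [_ lj rj] := iterP j.
have lje : l ^+ j <= expR 1.
  have -> : expR 1 = expR j%:R^-1 ^+ j :> R.
    by rewrite -expRM_natl mulfV// lt0r_neq0.
  by rewrite lerXn2r ?nnegrE ?(ltW l0) ?expR_ge0// expR_ge1Dx.
have : (1 + e / 2) ^+ j * (r m)%:R < (E + 1) * (r m)%:R.
  apply: (le_lt_trans rj); rewrite -ltr_pdivrMr//.
  apply: le_lt_trans (m1P m _); last by rewrite /= leq_maxr.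
  rewrite ler_pM2r ?invr_gt0//; apply: le_r.
  rewrite truncn_ge_nat ?mulr_ge0 ?expR_ge0//.
  by rewrite (le_trans lj)// ler_wpM2r.
rewrite ltr_pM2r// ltNge => /negP; apply.
apply: le_trans (_ : 1 + j%:R * (e / 2) <= _); last first.
  elim: (j) => [|i IH]; first by rewrite mul0r addr0 expr0.
  rewrite exprS -natr1.
  have : (1 + e / 2) * (1 + i%:R * (e / 2)) <= (1 + e / 2) * (1 + e / 2) ^+ i.
    by rewrite ler_wpM2l//; lra.
  have : 0 <= i%:R * (e / 2) * (e / 2) by rewrite !mulr_ge0//; lra.
  lra.
move: jE; rewrite ltr_pdivrMr; lra.
Qed.

Hypothesis rdiv : (\sum_(0 <= m <oo) ((r m)%:R ^- 2 : R)%:E)%E = +oo%E.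

Lemma rank_sum2_dvg : V n @[n --> \oo] --> +oo.
Proof.
apply/cvgryPge => A.
have [n An] : exists n, A <= V n.
  apply: contrapT => /forallNP H.
  suff : (\sum_(0 <= m <oo) ((r m)%:R ^- 2 :
    R)%:E <= A%:E)%E by rewrite rdiv leNgt ltry.
  apply: lime_le; first by apply: is_cvg_nneseries => n _ _;
    rewrite lee_fin invr_ge0 exprn_ge0.
  apply: nearW => n; rewrite sumEFin lee_fin big_mkord ltW// ltNge.
  by apply/negP; exact: H.
exists n => // m /= nm; exact: le_trans An (le_rank_sum2 r nm).
Qed.

Lemma rank_sum2_window m n : (m <= n)%N ->
  V n <= V m + (n - m)%N%:R / (r m)%:R ^+ 2.
Proof.
move=> mn; rewrite -{1}(subnK mn); elim: (n - m)%N => [|k IH].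
  by rewrite mul0r addr0.
rewrite addSn rank_sum2S -natr1 mulrDl mul1r addrA lerD//.
by rewrite lef_pV2 ?posrE ?exprn_gt0// lerXn2r ?nnegrE ?ler0n// le_r ?leq_addl.
Qed.

(* Otherwise [r (2 i) >= 3/2 r i] for large [i], and then
   [V i + 9 i / (r i)^2] does not increase when [i] is doubled. *)
Let half_limit (l : R) :
  (r (Num.truncn (2^-1 * m%:R : R)))%:R / (r m)%:R @[m --> \oo] --> l ->
  1 / 2 < l.
Proof.
move=> rl; rewrite ltNge; apply/negP => l2.
have [i0 _ i0P] : \forall m \near \oo,
    (r (Num.truncn (2^-1 * m%:R : R)))%:R / (r m)%:R < 2 / 3 :> R.
  by move/cvgr_lt : rl; apply; lra.
(* Doubling adds at most i / (r i)^2 to V and lowers the coefficient 9 of the second term to at most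
   9 times 2 times 4/9, that is 8; so 9 is the constant that breaks even. *)
pose pot i := V i + 9 * i%:R / (r i)%:R ^+ 2.
have dbl i : (i0 <= i)%N -> pot (2 * i)%N <= pot i.
  move=> i0i; have i0i2 : (i0 <= 2 * i)%N by lia.
  have := i0P _ i0i2; rewrite natrM mulKf// natrK.
  rewrite ltr_pdivrMr// => ri.
  have := @rank_sum2_window i (2 * i) _; rewrite leq_pmull// => /(_ isT).
  rewrite (_ : (2 * i - i)%N = i); last by lia.
  rewrite /pot natrM => Vi.
  have r2 : (9 / 4) * (r i)%:R ^+ 2 <= (r (2 * i)%N)%:R ^+ 2 :> R.
    have -> : (9 / 4) * (r i)%:R ^+ 2 = ((3 / 2) * (r i)%:R) ^+ 2 :> R by field.
    by rewrite lerXn2r ?nnegrE ?mulr_ge0//; lra.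
  have : 9 * (2 * i%:R) / (r (2 * i)%N)%:R ^+ 2 <= 8 * (i%:R / (r i)%:R ^+ 2) :> R.
    have -> : 8 * (i%:R / (r i)%:R ^+ 2) = 9 * (2 * i%:R) / ((9 / 4) *
      (r i)%:R ^+ 2) :> R.
      by field; rewrite lt0r_neq0.
    rewrite ler_wpM2l ?mulr_ge0// lef_pV2 ?posrE ?exprn_gt0//.
    by rewrite mulr_gt0 ?exprn_gt0.
  lra.
pose i1 := i0.+1.
have potj j : (i1 <= 2 ^ j * i1)%N /\ pot (2 ^ j * i1)%N <= pot i1.
  elim: j => [|j [ij pj]]; first by rewrite expn0 mul1n.
  have i0j : (i0 <= 2 ^ j * i1)%N by exact: leq_trans ij.
  rewrite expnS -mulnA; split; first by rewrite (leq_trans ij)// leq_pmull.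
  exact: le_trans (dbl _ i0j) pj.
have [n0 _ n0P] : \forall n \near \oo, pot i1 + 1 <= V n.
  exact: (cvgry_ge rank_sum2_dvg).
have n0j : (n0 <= 2 ^ n0 * i1)%N.
  by rewrite (leq_trans (ltnW (ltn_expl n0 (isT : 1 < 2)%N)))// leq_pmulr.
have := n0P _ n0j; have [_] := potj n0; rewrite {1}/pot.
have : 0 <= 9 * (2 ^ n0 * i1)%N%:R / (r (2 ^ n0 * i1))%:R ^+ 2 :> R.
  by rewrite divr_ge0 ?mulr_ge0// exprn_ge0.
lra.
Qed.

(** Up to boundary terms this is (beta(m)/m)^2. *)
Let B m : R := (r m)%:R ^+ 2 * V m / m%:R ^+ 2.

Let B_ge0 m : 0 <= B m.
Proof. by rewrite divr_ge0 ?mulr_ge0 ?exprn_ge0// sumr_ge0// => i _;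
  rewrite invr_ge0 exprn_ge0. Qed.

Let half m := Num.truncn (2^-1 * m%:R : R).

Let half_le m : (half m)%:R <= m%:R / 2 :> R.
Proof. by rewrite mulrC truncn_le mulr_ge0. Qed.

(** From r m <= r (half m) / rho and 2 half m <= m comes the factor q = 1/(4 rho^2), below 1 because
    [half_limit] leaves room for rho > 1/2; C/m accounts for the terms of V between half m and m. *)
Let B_half : exists q C : R, [/\ 0 <= q < 1, 0 <= C &
  \forall m \near \oo, B m <= q * B (half m) + C / m%:R].
Proof.
have [_ rv] := rRV.
have h20 : (0 : R) < 2^-1 by rewrite invr_gt0.
have [l l0 rl] := rv 2^-1 h20.
have l2 := half_limit rl.
have [rho rho2 rhol] : exists2 rho : R, 1 / 2 < rho & rho < l.
  by exists ((l + 1 / 2) / 2); lra.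
have rho0 : 0 < rho by lra.
exists (1 / (4 * rho ^+ 2)), (1 / rho ^+ 2); split.
- rewrite divr_ge0 ?mulr_ge0 ?exprn_ge0 ?(ltW rho0)//=.
  have r4 : 1 < 4 * rho ^+ 2.
    have : (1 / 2) * (1 / 2) < rho * rho by apply: ltr_pM => //; lra.
    by rewrite -expr2 -expr2; lra.
  by rewrite ltr_pdivrMr ?mul1r// (lt_trans _ r4).
- by rewrite divr_ge0 ?exprn_ge0 ?(ltW rho0).
have rhP : \forall m \near \oo, rho < (r (half m))%:R / (r m)%:R.
  by move/cvgr_gt : rl; apply; exact: rhol.
near=> m.
have m2 : (2 <= m)%N by near: m; exact: nbhs_infty_ge.
have m0 : (0 : R) < m%:R by rewrite ltr0n; lia.
have rh : rho < (r (half m))%:R / (r m)%:R.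
  by near: m.
have h1 : (1 <= half m)%N by rewrite truncn_ge_nat ?mulr_ge0// mulrC
  ler_pdivlMr// mul1r ler_nat.
have h0 : (0 : R) < (half m)%:R by rewrite ltr0n.
have hm : (half m <= m)%N by rewrite -(ler_nat R) (le_trans (half_le m))//; lra.
have Vm := rank_sum2_window hm.
have rr : (r m)%:R ^+ 2 <= (r (half m))%:R ^+ 2 / rho ^+ 2 :> R.
  rewrite -expr_div_n lerXn2r ?nnegrE ?divr_ge0 ?(ltW rho0)//.
  by rewrite ler_pdivlMr// -ler_pdivlMl// mulrC ltW.
have V0 k : 0 <= V k by rewrite sumr_ge0// => i _; rewrite invr_ge0 exprn_ge0.
have rh0 := r_gt0 (half m).
have step1 : (r m)%:R ^+ 2 * V m <=
    (r (half m))%:R ^+ 2 / rho ^+ 2 * (V (half m) + m%:R / (r (half m))%:R ^+ 2).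
  rewrite ler_pM ?exprn_ge0//; apply: le_trans Vm _.
  by rewrite lerD2l ler_pM2r ?invr_gt0 ?exprn_gt0// ler_nat leq_subr.
apply: le_trans (_ : (r (half m))%:R ^+ 2 / rho ^+ 2 * (V (half m) +
  m%:R / (r (half m))%:R ^+ 2) / m%:R ^+ 2 <= _).
  by rewrite ler_pM2r// invr_gt0 exprn_gt0.
have -> : (r (half m))%:R ^+ 2 / rho ^+ 2 * (V (half m) +
  m%:R / (r (half m))%:R ^+ 2) / m%:R ^+ 2 =
  (r (half m))%:R ^+ 2 * V (half m) / rho ^+ 2 * (m%:R ^+ 2)^-1 +
    1 / rho ^+ 2 / m%:R.
  by field; rewrite !lt0r_neq0.
rewrite lerD2r /B.
have -> : 1 / (4 * rho ^+ 2) * ((r (half m))%:R ^+ 2 *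
  V (half m) / (half m)%:R ^+ 2) =
  (r (half m))%:R ^+ 2 * V (half m) / rho ^+ 2 * (4 * (half m)%:R ^+ 2)^-1.
  by field; rewrite !lt0r_neq0.
rewrite ler_wpM2l ?divr_ge0 ?mulr_ge0 ?exprn_ge0 ?(ltW rho0)//.
rewrite lef_pV2 ?posrE ?mulr_gt0 ?exprn_gt0//.
have -> : 4 * (half m)%:R ^+ 2 = (2 * (half m)%:R) ^+ 2 :> R by ring.
rewrite lerXn2r ?nnegrE ?mulr_ge0//; have := half_le m; lra.
Unshelve. all: by end_near. Qed.

Let half_y : half m @[m --> \oo] --> \oo.
Proof.
move=> A [n _ nA]; exists (2 * n)%N => // m /= nm; apply: nA => /=.
rewrite truncn_ge_nat ?mulr_ge0// mulrC ler_pdivlMr//.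
by rewrite -natrM ler_nat mulnC.
Qed.

Let B_bounded : exists2 A, 0 <= A & forall m, B m <= A.
Proof.
have [q [C [/andP[q0 q1] C0 [m0 _ m0P]]]] := B_half.
(* A dominates all early values, and C <= (1 - q) A closes the induction through q A + C <= A. *)
pose A := \sum_(m < m0) B m + C / (1 - q).
have q1' : 0 < 1 - q by rewrite subr_gt0.
have S0 : 0 <= \sum_(m < m0) B m by exact: sumr_ge0.
have A0 : 0 <= A by rewrite addr_ge0// divr_ge0// ltW.
exists A => //; elim/ltn_ind => m IH.
have [mm0|mm0] := ltnP m m0.
  rewrite /A (bigD1 (Ordinal mm0))//= -addrA lerDl addr_ge0//.
    exact: sumr_ge0.
  by rewrite divr_ge0// ltW.
have [->|m1] := posnP m; first by rewrite /B expr0n invr0 mulr0.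
apply: le_trans (m0P _ mm0) _.
have hm : (half m < m)%N.
  rewrite truncn_lt_nat ?mulr_ge0// -(ltr_nat R) in m1 *; lra.
have := ler_wpM2l q0 (IH _ hm).
have : C / m%:R <= C by rewrite ler_pdivrMr ?ltr0n// ler_peMr// ler1n.
have : C <= (1 - q) * A.
  rewrite -ler_pdivrMl// mulrC /A lerDr//.
lra.
Qed.

(** For each fixed i, halving i times gives B m <= q^i A + e/2 for large m, each error C/m being
    absorbed in (1 - q) e/2; i is then taken large. *)
Lemma rank_sum2_negligible :
  (r m)%:R ^+ 2 * V m / m%:R ^+ 2 @[m --> \oo] --> (0 : R).
Proof.
have [q [C [/andP[q0 q1] C0 Bq]]] := B_half.
have [A A0 BA] := B_bounded.
apply/cvgrPdist_le => e e0; pose e2 := e / 2.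
have e20 : 0 < e2 by rewrite divr_gt0.
have iterP i : \forall m \near \oo, B m <= q ^+ i * A + e2.
  elim: i => [|i IH].
    by apply: nearW => m; rewrite expr0 mul1r (le_trans (BA m))// lerDl ltW.
  near=> m.
  have Bm : B m <= q * B (half m) + C / m%:R by near: m.
  have Bh : B (half m) <= q ^+ i * A + e2 by near: m; exact: half_y IH.
  have m0 : (0 : R) < m%:R by rewrite ltr0n; near: m; exact: nbhs_infty_gt.
  have Cm : C / m%:R <= (1 - q) * e2.
    rewrite ler_pdivrMr// -ler_pdivrMl ?mulr_gt0 ?subr_gt0//.
    by near: m; exact: nbhs_infty_ger.
  have := ler_wpM2l q0 Bh; rewrite exprS -mulrA; lra.
have [i qi] : exists i, q ^+ i * A <= e2.
  have : q ^+ i * A @[i --> \oo] --> 0 * A.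
    by apply: cvgM; [apply: cvg_expr; rewrite ger0_norm|exact: cvg_cst].
  rewrite mul0r => /cvgrPdist_le/(_ e2 e20)[i _ iP]; exists i.
  by have := iP i (leqnn i); rewrite sub0r normrN; apply: le_trans; exact: ler_norm.
near=> m; rewrite sub0r normrN ger0_norm; last exact: B_ge0.
have : B m <= q ^+ i * A + e2 by near: m.
rewrite /B /e2 in qi *; lra.
Unshelve. all: by end_near. Qed.

Lemma sum_itv_bounds (f : nat -> R) (a b : R) (m n : nat) : (m <= n)%N ->
  (forall j, (m <= j < n)%N -> a <= f j <= b) ->
  a * (n%:R - m%:R) <= \sum_(k < n) f k - \sum_(k < m) f k <= b * (n%:R - m%:R).
Proof.
move=> /subnK <-; elim: (n - m)%N => [|i IH] fab;
  first by rewrite !subrr !mulr0 lexx.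
have /andP[lo hi] : a <= f (i + m)%N <= b by apply: fab; rewrite leq_addl ltnS/=.
have /IH : forall j, (m <= j < i + m)%N -> a <= f j <= b.
  by move=> j /andP[mj ji]; apply: fab; rewrite mj addSn ltnS ltnW.
rewrite addSn big_ord_recr -natr1 /=; lra.
Qed.

Local Notation g := (@rank_sum R r).

(** Both signs of n - m are needed, since t may be negative. On the window r varies by at most a
    factor 1 + e, so g is linear with relative error e; the factor 4 bounds (1 + e)^2. *)
Lemma rank_sum_window (e : R) : 0 < e <= 1 ->
  exists2 kappa : R, 0 < kappa &
  \forall m0 \near \oo, forall m n, (m0 <= m)%N -> (m0 <= n)%N ->
    n%:R <= (1 + kappa) * m%:R :> R -> m%:R <= (1 + kappa) * n%:R :> R ->
    `|g n - g m - (n%:R - m%:R) / (r m)%:R| <= e * `|n%:R - m%:R| / (r m)%:R /\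
    `|V n - V m| <= 4 * `|n%:R - m%:R| / (r m)%:R ^+ 2.
Proof.
move=> /andP[e0 e1]; have [kappa k0 [m1 _ kP]] := rank_slow_variation e0.
exists kappa => //; exists m1 => // m0 /= m10 m n m0m m0n nm mn.
have rm0 := r_gt0 m.
have sq (j : nat) (c : R) : 0 <= c -> (r j)%:R^-1 <= c ->
  (r j)%:R ^- 2 <= c ^+ 2 :> R.
  by move=> c0 jc; rewrite -exprVn lerXn2r ?nnegrE ?invr_ge0.
have [mn'|/ltnW nm'] := leqP m n.
  have nm0 : 0 <= n%:R - m%:R :> R by rewrite subr_ge0 ler_nat.
  have rj j : (m <= j < n)%N ->
    (1 - e) * (r m)%:R^-1 <= ((r j)%:R^-1 : R) <= (r m)%:R^-1.
    move=> /andP[mj jn]; apply/andP; split; last by rewrite lef_pV2 ?posrE// le_r.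
    have rje : (r j)%:R <= (1 + e) * (r m)%:R :> R.
      apply: (kP m0 m10) => //; first by rewrite m0m.
      by apply: le_trans nm; rewrite ler_nat ltnW.
    rewrite -[leRHS]mul1r ler_pdivrMr// mulrAC ler_pdivlMr//.
    have : (1 - e) * (r j)%:R <= (1 - e) * ((1 + e) *
      (r m)%:R) by rewrite ler_wpM2l// subr_ge0.
    have : 0 <= e * e * (r m)%:R by rewrite !mulr_ge0// ltW.
    lra.
  have /andP[G1 G2] := @sum_itv_bounds (fun j => (r j)%:R^-1) _ _ m n mn' rj.
  have rj2 j : (m <= j < n)%N -> 0 <= ((r j)%:R ^- 2 : R) <= (r m)%:R^-1 ^+ 2.
    by move=> /rj/andP[_ rjm]; rewrite invr_ge0 exprn_ge0//= sq ?invr_ge0.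
  have /andP[V1 V2] := @sum_itv_bounds (fun j => (r j)%:R ^- 2) _ _ m n mn' rj2.
  split.
    rewrite (ger0_norm nm0) ler_norml /rank_sum; apply/andP.
    move: G1 G2; rewrite -/(g m) -/(g n).
    set d := n%:R - m%:R in nm0 *; set G := g n - g m.
    have : 0 <= e * d / (r m)%:R by rewrite divr_ge0 ?mulr_ge0// ltW.
    by split; lra.
  rewrite (ger0_norm nm0); move: V1 V2; rewrite mul0r -/(V n) -/(V m) => V1 V2.
  rewrite ger0_norm//; apply: le_trans V2 _.
  rewrite exprVn mulrC ler_wpM2r ?invr_ge0 ?exprn_ge0// ler_peMl//; lra.
have mn0 : 0 <= m%:R - n%:R :> R by rewrite subr_ge0 ler_nat.
have rj j : (n <= j < m)%N ->
  (r m)%:R^-1 <= ((r j)%:R^-1 : R) <= (1 + e) * (r m)%:R^-1.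
  move=> /andP[nj jm]; apply/andP; split.
    by rewrite lef_pV2 ?posrE// le_r// ltnW.
  have rje : (r m)%:R <= (1 + e) * (r j)%:R :> R.
    apply: (kP m0 m10); first by rewrite (leq_trans m0n nj) ltnW.
    apply: le_trans mn _; rewrite ler_wpM2l ?ler_nat//; lra.
  rewrite -[leLHS]mul1r ler_pdivrMr// mulrAC ler_pdivlMr// mul1r//.
have /andP[G1 G2] := @sum_itv_bounds (fun j => (r j)%:R^-1) _ _ n m nm' rj.
have rj2 j : (n <= j < m)%N ->
  0 <= ((r j)%:R ^- 2 : R) <= ((1 + e) * (r m)%:R^-1) ^+ 2.
  move=> /rj/andP[_ rjm].
  by rewrite invr_ge0 exprn_ge0//= sq ?mulr_ge0 ?invr_ge0 ?addr_ge0 ?(ltW e0).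
have /andP[V1 V2] := @sum_itv_bounds (fun j => (r j)%:R ^- 2) _ _ n m nm' rj2.
split.
  rewrite distrC (_ : _ - _ = g m - g n - (m%:R - n%:R) / (r m)%:R);
    last by field; rewrite lt0r_neq0.
  rewrite (distrC n%:R) (ger0_norm mn0) ler_norml; apply/andP.
  move: G1 G2; rewrite -/(g m) -/(g n).
  set d := m%:R - n%:R in mn0 *; set G := g m - g n.
  have : 0 <= e * d / (r m)%:R by rewrite divr_ge0 ?mulr_ge0// ltW.
  by split; lra.
rewrite distrC (distrC n%:R) (ger0_norm mn0).
move: V1 V2; rewrite mul0r -/(V n) -/(V m) => V1 V2.
rewrite ger0_norm//; apply: le_trans V2 _.
rewrite exprMn exprVn mulrAC ler_wpM2r ?invr_ge0 ?exprn_ge0// ler_wpM2r//.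
have : (1 + e) ^+ 2 <= 2 ^+ 2 by rewrite lerXn2r ?nnegrE//; lra.
lra.
Qed.

Local Notation H n := (series (@harmonic R) n).

Lemma ln_succ_bounds (x : R) : 0 < x -> (x + 1)^-1 <= ln (x + 1) - ln x <= x^-1.
Proof.
move=> x0; have x1 : 0 < x + 1 by rewrite addr_gt0.
have xn0 : x != 0 by rewrite lt0r_neq0.
have x1n0 : x + 1 != 0 by rewrite lt0r_neq0.
apply/andP; split.
  rewrite -lerN2 opprB -ln_div ?posrE//.
  rewrite (_ : x / (x + 1) = 1 + - (x + 1)^-1); last by field.
  by apply: le_ln1Dx; rewrite ltrN2 invf_lt1// ltrDr.
rewrite -ln_div ?posrE//.
rewrite (_ : (x + 1) / x = 1 + x^-1); last by field.
by apply: le_ln1Dx; rewrite (@lt_trans _ _ 0)// ?invr_gt0// ltrN10.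
Qed.

Lemma harmonic_ln_dist n : (0 < n)%N -> `|H n - ln n%:R| <= 1.
Proof.
case: n => // n _; suff : ln n.+2%:R <= H n.+1 <= 1 + ln n.+1%:R.
  move=> /andP[lo hi].
  have : ln n.+1%:R <= ln n.+2%:R :> R by rewrite ler_ln ?posrE// ler_nat.
  by move: (H n.+1) lo hi => h lo hi; rewrite ler_norml; lra.
elim: n => [|n /andP[lo hi]].
  rewrite seriesSr /series /= big_nil add0r /harmonic /= invr1 ln1 addr0 lexx andbT.
  have /andP[_] := ln_succ_bounds (@ltr01 R).
  by rewrite ln1 subr0 invr1.
rewrite seriesSr (_ : harmonic n.+1 = n.+2%:R^-1)//.
have /andP[_] := ln_succ_bounds (ltr0n R n.+2); rewrite natr1.
have /andP[+ _] := ln_succ_bounds (ltr0n R n.+1); rewrite natr1.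
move: (H n.+1) lo hi => h.
by move: (ln n.+3%:R) (ln n.+2%:R) (ln n.+1%:R) (n.+2%:R^-1) => *; apply/andP; lra.
Qed.

(** * Asymptotics at the threshold mu(n) + t gamma(n) *)

Variable mu : nat -> R.
Hypothesis muP : (fun n => \sum_(1 <= k < (Num.truncn (mu n)).+1) (r k)%:R^-1) =
         (fun n => ln n%:R) +O_\oo (fun=> 1 : R).

Let K n := Num.truncn (mu n).

Let r0E : r 0%N = 1%N. Proof. by case: rP. Qed.

(** Against the sum in [muP], g (K n) has the extra term k = 0 and lacks k = K n; these two and the
    distance from H n to ln n cost at most 1 each. *)
Lemma rank_sum_harmonic : exists C : R,
  \forall n \near \oo, `|g (K n) - H n| <= C.
Proof.
have : (fun n => \sum_(1 <= k < (K n).+1) (r k)%:R^-1) - (fun n => ln n%:R)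
  =O_\oo (fun=> 1 : R).
  by rewrite muP addrAC subrr add0r.
move=> /eqO_exP[C C0 CP]; exists (C + 3); near=> n.
have n0 : (0 < n)%N by near: n; exact: nbhs_infty_gt.
have Hln := harmonic_ln_dist n0.
have : `|\sum_(1 <= k < (K n).+1) (r k)%:R^-1 - ln n%:R| <= C * `|1 : R|.
  by near: n.
rewrite normr1 mulr1.
have := @rank_sumS R r (K n);
  rewrite {1}/rank_sum -(big_mkord xpredT (fun i => (r i)%:R^-1)).
rewrite big_ltn// r0E invr1.
set s := \sum_(1 <= i < (K n).+1) _ => sE.
have : 0 <= (r (K n))%:R^-1 :> R by rewrite invr_ge0.
have : (r (K n))%:R^-1 <= 1 :> R by rewrite invf_le1// rank_ge1.
move: (H n) (ln n%:R) Hln => h l; rewrite !ler_norml; lra.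
Unshelve. all: by end_near. Qed.

Lemma harmonic_y : H n @[n --> \oo] --> +oo.
Proof.
apply/cvgryPge => A; near=> n.
have n0 : (0 < n)%N by near: n; exact: nbhs_infty_gt.
have := harmonic_ln_dist n0.
have : A + 1 <= ln n%:R.
  rewrite -[leLHS]expRK ler_ln ?posrE ?expR_gt0 ?ltr0n//.
  by near: n; exact: nbhs_infty_ger.
by move: (H n) (ln n%:R) => h l; rewrite ler_norml; lra.
Unshelve. all: by end_near. Qed.

Lemma rank_index_y : K n @[n --> \oo] --> \oo.
Proof.
have [C CP] := rank_sum_harmonic.
move=> A [m _ mA]; suff : \forall n \near \oo, (m <= K n)%N.
  by apply: filterS => n mK; exact: mA.
have HP : \forall n \near \oo, g m + C + 1 <= H n.
  exact: (cvgry_ge harmonic_y).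
near=> n; rewrite leqNgt; apply/negP => /ltnW Km.
have Cn : `|g (K n) - H n| <= C by near: n.
have Hn : g m + C + 1 <= H n by near: n.
have : g (K n) <= g m.
  rewrite -(subnK Km); elim: (m - K n)%N => [//|i];
    rewrite addSn rank_sumS => /le_trans; apply.
  by rewrite lerDl invr_ge0.
move: Cn Hn; move: (H n) => h; rewrite ler_norml; lra.
Unshelve. all: by end_near. Qed.

Let near_index (A : nat -> Prop) :
  (\forall m \near \oo, A m) -> \forall n \near \oo, A (K n).
Proof. exact: rank_index_y. Qed.

(** [gam] is the standard deviation on the scale of counts, [sg] the one on the scale of g, whose
    slope at K n is 1 / r (K n). *)
Let gam n : R := beta r (K n).
Let sg n : R := gam n / (r (K n))%:R.

Lemma beta_sqr m : (beta r m : R) ^+ 2 = (r m)%:R ^+ 2 * (V m.+1 - 1).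
Proof.
have V1 : V m.+1 - 1 = \sum_(1 <= k < m.+1) (r k)%:R ^- 2.
  rewrite /rank_sum2 -(big_mkord xpredT (fun i => (r i)%:R ^- 2)) big_ltn// r0E.
  by rewrite expr1n invr1 addrAC subrr add0r.
by rewrite V1 sqr_sqrtr// mulr_ge0 ?exprn_ge0// sumr_ge0.
Qed.

Let beta_ge0 m : 0 <= beta r m :> R. Proof. exact: sqrtr_ge0. Qed.

Let sg_sqr n : sg n ^+ 2 = V (K n).+1 - 1.
Proof. by rewrite expr_div_n beta_sqr mulrAC mulfV ?mul1r// expf_neq0//
  lt0r_neq0. Qed.

Lemma sd_y : sg n @[n --> \oo] --> +oo.
Proof.
apply/cvgryPge => A.
have : \forall m \near \oo, A ^+ 2 + 1 <= V m by exact: (cvgry_ge rank_sum2_dvg).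
move=> /near_index; apply: filterS => n /= AV.
have s0 : 0 <= sg n by exact: divr_ge0 (beta_ge0 _) (ler0n _ _).
rewrite (le_trans (ler_norm A))// -(ger0_norm s0) -ler_sqr ?nnegrE//
  !real_normK ?num_real//.
have : V (K n) <= V (K n).+1 by exact: le_rank_sum2.
by rewrite sg_sqr; lra.
Qed.

Lemma beta_y : gam n @[n --> \oo] --> +oo.
Proof.
apply/cvgryPge => A;
  have : \forall n \near \oo, A <= sg n by exact: (cvgry_ge sd_y).
apply: filterS => n /le_trans; apply.
by rewrite ler_pdivrMr// -[leLHS]mulr1 ler_wpM2l ?beta_ge0 ?rank_ge1.
Qed.

Lemma beta_small (c : R) : 0 < c -> \forall n \near \oo, gam n <= c * (K n)%:R.
Proof.
move=> c0.
have nz : \forall m \near \oo, (r m)%:R ^+ 2 * V m / m%:R ^+ 2 <= c ^+ 2.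
  have c20 : 0 < c ^+ 2 by rewrite exprn_gt0.
  move/cvgrPdist_le : rank_sum2_negligible => /(_ _ c20); apply: filterS => m.
  by rewrite sub0r normrN => /(le_trans (ler_norm _)).
have pos : \forall m \near \oo, (0 < m)%N by exact: nbhs_infty_gt.
have := near_index nz; have := near_index pos; apply: filterS2 => n K0 cV.
have Kp : (0 : R) < (K n)%:R by rewrite ltr0n.
have c1 : 0 <= c * (K n)%:R by rewrite mulr_ge0// ltW.
rewrite -ler_sqr ?nnegrE ?beta_ge0// /gam beta_sqr exprMn -ler_pdivrMr ?exprn_gt0//.
apply: le_trans cV; rewrite ler_pM2r ?invr_gt0 ?exprn_gt0// ler_pM2l ?exprn_gt0//.
rewrite rank_sum2S; have : (r (K n))%:R ^- 2 <= 1 :> R; last lra.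
by rewrite invf_le1 ?exprn_gt0// exprn_ege1// rank_ge1.
Qed.

Variable t : R.
Let b n : R := mu n + t * gam n.
(** When b n >= 0, a count is at most b n exactly when it is below N n. *)
Let N n : nat := (Num.truncn (b n)).+1.

Let mu_itv n : (0 < K n)%N -> (K n)%:R <= mu n < (K n)%:R + 1.
Proof. by rewrite truncn_gt0 natr1 => mu1;
  rewrite truncn_itv// (le_trans _ mu1). Qed.

(** [truncn] sends negative reals to 0, so truncating the threshold is faithful only once it is
    nonnegative; beta(m) = o(m) ensures this for every t. *)
Lemma threshold_ge0 : \forall n \near \oo, 0 <= mu n + t * gam n.
Proof.
have t1 : 0 < (`|t| + 1)^-1 by rewrite invr_gt0 ltr_wpDl.
have K0 : \forall n \near \oo, (0 < K n)%N.
  exact: (near_index (nbhs_infty_gt 0)).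
have bs := beta_small t1.
near=> n.
have Kn : (0 < K n)%N by near: n.
have : gam n <= (`|t| + 1)^-1 * (K n)%:R by near: n.
rewrite mulrC ler_pdivlMr ?ltr_wpDl// => gK.
have /andP[Kmu _] := mu_itv Kn.
have g0 := beta_ge0 (K n); rewrite -/(gam n) in g0.
have := ler_norm (- (t * gam n)); rewrite normrN normrM (ger0_norm g0); lra.
Unshelve. all: by end_near. Qed.

(** The truncations of mu n and of b n cost at most 1 each, whence the 2. *)
Let window (e : R) : 0 < e <= 1 -> \forall n \near \oo,
  [/\ `|g (N n) - g (K n) - ((N n)%:R - (K n)%:R) / (r (K n))%:R| <=
        e * `|(N n)%:R - (K n)%:R| / (r (K n))%:R,
      `|V (N n) - V (K n)| <= 4 * `|(N n)%:R - (K n)%:R| / (r (K n))%:R ^+ 2 &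
      `|(N n)%:R - (K n)%:R - t * gam n| <= 2].
Proof.
move=> e01; have [kp kp0 [m0 _ m0P]] := rank_sum_window e01.
(* As (1 + kp) (1 - k') = 1, the bound |N - K| <= k' K yields both ratio conditions of
   [rank_sum_window]. *)
pose k' := kp / (1 + kp).
have kp1 : 0 < 1 + kp by rewrite addr_gt0.
have k'0 : 0 < k' by rewrite divr_gt0.
have k'kp : k' <= kp by rewrite ler_pdivrMr// ler_peMr ?(ltW kp0)// lerDl ltW.
have k'E : (1 + kp) * (1 - k') = 1 by rewrite /k'; field; rewrite lt0r_neq0.
have c0 : 0 < k' / 2 / (`|t| + 1) by rewrite !divr_gt0// ltr_wpDl.
have bs := beta_small c0.
have K0 : \forall n \near \oo, (0 < K n)%N.
  exact: (near_index (nbhs_infty_gt 0)).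
have Km : \forall n \near \oo, (m0 <= K n)%N.
  exact: (near_index (nbhs_infty_ge m0)).
(* 4 / k' absorbs the truncation error 2 into half of k' K, and (1 + kp) m0 forces N n >= m0. *)
have K4 : \forall n \near \oo, 4 / k' + (1 + kp) * m0%:R <= (K n)%:R.
  exact: (near_index (nbhs_infty_ger (4 / k' + (1 + kp) * m0%:R))).
have b0 := threshold_ge0.
near=> n.
have Kn : (0 < K n)%N by near: n.
have /andP[Kmu muK] := mu_itv Kn.
have bn0 : 0 <= b n by near: n.
have /andP[Nb bN] := truncn_itv bn0.
have NE : (N n)%:R = (Num.truncn (b n))%:R + 1 :> R by rewrite natr1.
have D2 : `|(N n)%:R - (K n)%:R - t * gam n| <= 2.
  rewrite -natr1 in bN; rewrite NE; rewrite /b in Nb bN *.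
  by move: Nb bN; set T := (Num.truncn _)%:R => Nb bN; rewrite ler_norml; lra.
have g0 := beta_ge0 (K n); rewrite -/(gam n) in g0.
have gK : gam n * (`|t| + 1) <= k' / 2 * (K n)%:R.
  rewrite -ler_pdivlMr ?ltr_wpDl// mulrAC; by near: n.
have tg : `|t * gam n| <= k' / 2 * (K n)%:R.
  by rewrite normrM (ger0_norm g0); lra.
have K4n : 4 / k' + (1 + kp) * m0%:R <= (K n)%:R by near: n.
have m0p : 0 <= (1 + kp) * m0%:R by rewrite mulr_ge0// ltW.
have two : 2 <= k' / 2 * (K n)%:R.
  have : k' / 2 * (4 / k' + (1 + kp) * m0%:R) <= k' / 2 * (K n)%:R.
    by rewrite ler_wpM2l// divr_ge0// ltW.
  have -> : k' / 2 * (4 / k' + (1 + kp) * m0%:R) = 2 + k' / 2 * ((1 + kp) * m0%:R).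
    by field; rewrite lt0r_neq0.
  have : 0 <= k' / 2 * ((1 + kp) * m0%:R) by rewrite mulr_ge0// divr_ge0// ltW.
  lra.
have DK : `|(N n)%:R - (K n)%:R| <= k' * (K n)%:R.
  rewrite (_ : (N n)%:R - (K n)%:R = ((N n)%:R - (K n)%:R - t * gam n) + t *
    gam n); last by ring.
  by rewrite (le_trans (ler_normD _ _))//; lra.
have Kp : (0 : R) <= (K n)%:R by [].
have kK := ler_wpM2r Kp k'kp.
have NK : (1 - k') * (K n)%:R <= (N n)%:R by move: DK; rewrite ler_norml; lra.
have KN : (K n)%:R <= (1 + kp) * (N n)%:R.
  by have := ler_wpM2l (ltW kp1) NK; rewrite mulrA k'E mul1r.
have m0N : (m0 <= N n)%N.
  rewrite -(ler_nat R); have : (1 + kp) * m0%:R <= (1 + kp) * (N n)%:R.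
    by apply: le_trans KN; apply: le_trans K4n; rewrite lerDr divr_ge0// ltW.
  by rewrite ler_pM2l.
have Nle : (N n)%:R <= (1 + kp) * (K n)%:R by move: DK; rewrite ler_norml; lra.
have m0K : (m0 <= K n)%N by near: n.
by have [W1 W2] := m0P m0 (leqnn m0) (K n) (N n) m0K m0N Nle KN.
Unshelve. all: by end_near. Qed.

(** Splitting at K n leaves three errors, each at most e/4 after division by sg: the linearization
    of g, the truncation in N n - K n, and the bounded difference g (K n) - H n. *)
Lemma threshold_sum_cvg :
  (g (N n) - H n) / sg n @[n --> \oo] --> t.
Proof.
apply/cvgrPdist_le => e e0.
have [C CP] := rank_sum_harmonic.
have tt : 0 < `|t| + 2 by rewrite ltr_wpDl.
pose e' := Num.min 1 (e / 4 / (`|t| + 2)).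
have e'0 : 0 < e' by rewrite lt_min ltr01 !divr_gt0.
have e'1 : 0 < e' <= 1 by rewrite e'0 ge_min lexx.
have e'e : e' * (`|t| + 2) <= e / 4 by rewrite -ler_pdivlMr// ge_min lexx orbT.
have win := window e'1.
have gb : \forall n \near \oo, 1 + 8 / e <= gam n by exact: (cvgry_ge beta_y).
have sb : \forall n \near \oo, 1 + 4 * `|C| / e <= sg n by exact: (cvgry_ge sd_y).
near=> n.
have [W1 _ W3] : [/\ `|g (N n) - g (K n) - ((N n)%:R - (K n)%:R) / (r (K n))%:R| <=
        e' * `|(N n)%:R - (K n)%:R| / (r (K n))%:R,
      `|V (N n) - V (K n)| <= 4 * `|(N n)%:R - (K n)%:R| / (r (K n))%:R ^+ 2 &
      `|(N n)%:R - (K n)%:R - t * gam n| <= 2] by near: n.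
have Cn : `|g (K n) - H n| <= C by near: n.
have gn : 1 + 8 / e <= gam n by near: n.
have sn : 1 + 4 * `|C| / e <= sg n by near: n.
have rK := r_gt0 (K n).
have e8 : 0 <= 8 / e by rewrite divr_ge0// ltW.
have g0 : 0 < gam n by apply: lt_le_trans gn; rewrite ltr_wpDr.
have s0 : 0 < sg n by rewrite divr_gt0.
have gE : gam n = sg n * (r (K n))%:R by rewrite divfK// lt0r_neq0.
set D := (N n)%:R - (K n)%:R in W1 W3 *.
have part1 : `|(g (N n) - g (K n)) / sg n - D / gam n| <= e / 4.
  have -> : (g (N n) - g (K n)) / sg n - D / gam n =
            (g (N n) - g (K n) - D / (r (K n))%:R) / sg n.
    by rewrite gE; field; rewrite !lt0r_neq0.
  rewrite normrM normfV (gtr0_norm s0) ler_pdivrMr//.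
  apply: le_trans W1 _; rewrite ler_pdivrMr// -mulrA -gE.
  apply: le_trans (_ : e' * ((`|t| + 2) * gam n) <= _).
    rewrite ler_wpM2l ?(ltW e'0)//.
    have -> : D = (D - t * gam n) + t * gam n by ring.
    apply: le_trans (ler_normD _ _) _; rewrite normrM (gtr0_norm g0).
    by rewrite mulrDl addrC lerD2l (le_trans W3)// ler_peMr//; lra.
  by rewrite mulrA ler_wpM2r// ltW.
have part2 : `|D / gam n - t| <= e / 4.
  have -> : D / gam n - t = (D - t * gam n) / gam n by field; rewrite lt0r_neq0.
  rewrite normrM normfV (gtr0_norm g0) ler_pdivrMr//; apply: le_trans W3 _.
  apply: le_trans (_ : e / 4 * (8 / e) <= _); last by rewrite ler_wpM2l//; lra.
  by have -> : e / 4 * (8 / e) = 2 by field; rewrite lt0r_neq0.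
have part3 : `|(g (K n) - H n) / sg n| <= e / 4.
  rewrite normrM normfV (gtr0_norm s0) ler_pdivrMr//; apply: le_trans Cn _.
  apply: le_trans (ler_norm C) _.
  apply: le_trans (_ : e / 4 * (4 * `|C| / e) <= _);
    last by rewrite ler_wpM2l//; lra.
  by have -> : e / 4 * (4 * `|C| / e) = `|C| by field; rewrite lt0r_neq0.
have -> : t - (g (N n) - H n) / sg n = - ((g (N n) - g (K n)) / sg n - D / gam n)
   - (D / gam n - t) - (g (K n) - H n) / sg n.
  move: (H n) => h; field; rewrite !lt0r_neq0//.
apply: (@le_trans _ _ (e / 4 + e / 4 + e / 4)); last by lra.
apply: le_trans (ler_normB _ _) _; apply: lerD => //.
apply: le_trans (ler_normB _ _) _; apply: lerD => //.
by rewrite normrN.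
Unshelve. all: by end_near. Qed.

(** As N n - K n = O(gam), V (N n) - V (K n) is O(gam / r^2) = O(sg^2 / gam), and V (K n) differs
    from sg^2 by at most 1. *)
Lemma threshold_sum2_cvg : V (N n) / sg n ^+ 2 @[n --> \oo] --> (1 : R).
Proof.
apply/cvgrPdist_le => e e0.
have tt : 0 < `|t| + 2 by rewrite ltr_wpDl.
have win := @window 1 (ltac:(by rewrite ltr01 lexx)).
have gb : \forall n \near \oo, 1 + 8 * (`|t| +
  2) / e <= gam n by exact: (cvgry_ge beta_y).
have sb : \forall n \near \oo, 1 + 2 / e <= sg n by exact: (cvgry_ge sd_y).
near=> n.
have [_ W2 W3] : [/\ `|g (N n) - g (K n) - ((N n)%:R - (K n)%:R) / (r (K n))%:R| <=
        1 * `|(N n)%:R - (K n)%:R| / (r (K n))%:R,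
      `|V (N n) - V (K n)| <= 4 * `|(N n)%:R - (K n)%:R| / (r (K n))%:R ^+ 2 &
      `|(N n)%:R - (K n)%:R - t * gam n| <= 2] by near: n.
have gn : 1 + 8 * (`|t| + 2) / e <= gam n by near: n.
have sn : 1 + 2 / e <= sg n by near: n.
have rK := r_gt0 (K n).
have e2 : 0 <= 2 / e by rewrite divr_ge0// ltW.
have e8 : 0 <= 8 * (`|t| + 2) / e by rewrite divr_ge0 ?mulr_ge0// ltW.
have g0 : 0 < gam n by apply: lt_le_trans gn; rewrite ltr_wpDr.
have s0 : 0 < sg n by rewrite divr_gt0.
have gE : gam n = sg n * (r (K n))%:R by rewrite divfK// lt0r_neq0.
set D := (N n)%:R - (K n)%:R in W2 W3 *.
have part1 : `|(V (N n) - V (K n)) / sg n ^+ 2| <= e / 2.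
  have s20 : 0 < sg n ^+ 2 by rewrite exprn_gt0.
  rewrite normrM normfV (gtr0_norm s20) ler_pdivrMr//.
  apply: le_trans W2 _; rewrite ler_pdivrMr ?exprn_gt0// -mulrA -exprMn -gE.
  have DB : `|D| <= (`|t| + 2) * gam n.
    have -> : D = (D - t * gam n) + t * gam n by ring.
    apply: le_trans (ler_normD _ _) _; rewrite normrM (gtr0_norm g0).
    by rewrite mulrDl addrC lerD2l (le_trans W3)// ler_peMr//; lra.
  apply: le_trans (_ : 4 * ((`|t| + 2) * gam n) <= _); first by rewrite ler_wpM2l.
  rewrite expr2 !mulrA ler_wpM2r ?(ltW g0)//.
  apply: le_trans (_ : e / 2 * (8 * (`|t| + 2) / e) <= _);
    last by rewrite ler_wpM2l//; lra.
  have -> : e / 2 * (8 * (`|t| + 2) / e) = 4 * (`|t| + 2) by field;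
    rewrite lt0r_neq0.
  by [].
have part2 : `|1 - V (K n) / sg n ^+ 2| <= e / 2.
  have s20 : 0 < sg n ^+ 2 by rewrite exprn_gt0.
  have -> : 1 - V (K n) / sg n ^+ 2 = (sg n ^+ 2 - V (K n)) / sg n ^+ 2.
    by field; rewrite lt0r_neq0.
  rewrite normrM normfV (gtr0_norm s20) ler_pdivrMr//.
  apply: (@le_trans _ _ 1).
    rewrite sg_sqr rank_sum2S.
    have : 0 <= (r (K n))%:R ^- 2 :> R by rewrite invr_ge0 exprn_ge0.
    have : (r (K n))%:R ^- 2 <= 1 :> R.
      by rewrite invf_le1 ?exprn_gt0// exprn_ege1// rank_ge1.
    by rewrite ler_norml; lra.
  apply: le_trans (_ : e / 2 * (2 / e) <= _).
    by have -> : e / 2 * (2 / e) = 1 by field; rewrite lt0r_neq0.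
  rewrite ler_wpM2l ?divr_ge0 ?(ltW e0)//; apply: le_trans (_ : sg n <= _);
    first by lra.
  by rewrite ler_eXnr//; lra.
have -> : 1 - V (N n) / sg n ^+ 2 = (1 - V (K n) / sg n ^+ 2) - (V (N n) - V (K
  n)) / sg n ^+ 2.
  by field; rewrite lt0r_neq0.
by apply: le_trans (ler_normB _ _) _; lra.
Unshelve. all: by end_near. Qed.

End rank_asymptotics.

(** * Independence of the relative ranks *)

Definition insert_at A (i : nat) (a : A) (s : seq A) : seq A :=
  take i s ++ a :: drop i s.

(* The indices below [n] listed by decreasing value, given the numbers [c i]
   of earlier values that dominate the [i]-th one. *)
Fixpoint rank_order (c : nat -> nat) (n : nat) : seq nat :=
  if n is n'.+1 then insert_at (c n') n' (rank_order c n') else [::].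

Lemma perm_rank_order c n : perm_eq (rank_order c n) (iota 0 n).
Proof.
elim: n => [//|n /seq.permP IH]; apply/seq.permP => p.
rewrite -addn1 iotaD count_cat -IH addn1 /= /insert_at count_cat /= addnCA.
by rewrite -count_cat cat_take_drop addn0 addnC.
Qed.

Lemma map_insert_at A B (f : A -> B) i a s :
  map f (insert_at i a s) = insert_at i (f a) (map f s).
Proof. by rewrite /insert_at map_cat map_take /= map_drop. Qed.

Lemma sorted_insert_at (R : realDomainType) (s : seq R) (y : R) i :
  sorted >%R s -> y \notin s -> (i <= size s)%N ->
  sorted >%R (insert_at i y s) = (count (fun z => y <= z) s == i).
Proof.
have tr : transitive (>%R : rel R) by move=> a b c ab /lt_trans; apply.
elim: s i => [[]//|a s IH] [|i]; rewrite /insert_at /=.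
  move=> pa; rewrite inE negb_or => /andP[ya _] _; rewrite pa andbT.
  have [ay|ay] := ltP a y; last by rewrite add1n.
  rewrite add0n; move: pa; rewrite path_sortedE// => /andP[/allP sa _].
  apply/esym; rewrite -leqn0 leqNgt -has_count; apply/hasPn => z /sa za.
  by rewrite -ltNge (lt_trans za).
move=> pa; rewrite inE negb_or ltnS => /andP[ya ys] si.
move: (pa); rewrite path_sortedE// => /andP[sa ss].
rewrite path_sortedE// IH// all_cat /=.
have -> : all (fun z => z < a) (take i s).
  by apply/allP => z /mem_take /(allP sa).
have -> : all (fun z => z < a) (drop i s).
  by apply/allP => z /mem_drop /(allP sa).
rewrite andbT lt_neqAle ya /=.
case: leP => ay /=; first by rewrite add1n eqSS.
apply/esym/negbTE; rewrite add0n.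
suff -> : count (fun z => y <= z) s = 0%N by [].
apply/eqP; rewrite -leqn0 leqNgt -has_count; apply/hasPn => z /(allP sa) za.
by rewrite -ltNge (lt_trans za).
Qed.

(** Prescribing the ranks amounts to prescribing the decreasing order of the values; exchangeability
    will then give all admissible rank vectors the same probability. *)
Lemma sorted_rank_order (R : realType) (x : nat -> R) c n :
  uniq (mkseq x n) -> (forall i, (c i <= i)%N) ->
  sorted >%R (map x (rank_order c n)) <->
  forall i, (i < n)%N -> ranking x i = c i.
Proof.
move=> + cle; elim: n => [//|n IH]; rewrite mkseqS rcons_uniq => /andP[xn ux].
move: IH => /(_ ux) IH.
have pm := perm_map x (perm_rank_order c n).
have ro : size (map x (rank_order c n)) = n.
  by rewrite size_map (perm_size (perm_rank_order c n)) size_iota.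
have key : sorted >%R (map x (rank_order c n)) ->
    sorted >%R (map x (rank_order c n.+1)) = (ranking x n == c n).
  move=> so; rewrite map_insert_at sorted_insert_at//.
  - by rewrite /ranking; have /seq.permP -> := pm.
  - by rewrite (perm_mem pm).
  - by rewrite ro.
split=> [so|H].
  have so' : sorted >%R (map x (rank_order c n)).
    apply: subseq_sorted so; first by move=> a b e ab /lt_trans; apply.
    rewrite map_insert_at /insert_at -{1}(cat_take_drop (c n) (map x
      (rank_order c n))).
    by apply: cat_subseq => //; exact: subseq_cons.
  move=> i; rewrite ltnS leq_eqVlt => /orP[/eqP ->|]; last exact: (IH.1 so').
  by apply/eqP; rewrite -key.
have so : sorted >%R (map x (rank_order c n)).
  by apply: IH.2 => i ilt; apply: H; rewrite ltnS ltnW.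
by rewrite key// H.
Qed.

Lemma continuous_cdf_set1 d (T : measurableType d) (R : realType)
    (P : probability T R) (X : {RV P >-> R}) (x : R) :
  continuous (cdf X) -> distribution P X [set x] = 0%E.
Proof.
move=> cX; apply/eqP; rewrite eq_le measure_ge0 andbT.
have cvg0 : (cdf X x - cdf X (x - n.+1%:R^-1))%E @[n --> \oo] --> 0%E.
  have <- : (cdf X x - cdf X x)%E = 0%E.
    by rewrite subee// fin_num_measure.
  apply: cvgeB => //.
  - by rewrite fin_num_adde_defr// fin_num_measure.
  - exact: cvg_cst.
  - apply: (@cvg_comp _ _ _ (fun n : nat => x - n.+1%:R^-1) (cdf X) \oo (nbhs x)).
      have : (x - n.+1%:R^-1) @[n --> \oo] --> x - 0.
        by apply: cvgB; [exact: cvg_cst|exact: cvg_harmonic].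
      by rewrite subr0.
    exact: cX.
apply: (cvge_to_ge cvg0); apply: nearW => n.
rewrite leeBrDr ?fin_num_measure//.
rewrite /cdf -measureU//.
- apply: le_measure; rewrite ?inE//.
    by apply: measurableU => //; exact: measurable_set1.
  move=> y [->|]; rewrite /= !in_itv/= ?lexx// => /le_trans; apply.
  by rewrite gerBl.
- apply/seteqP; split => // y [-> /=]; rewrite in_itv/=.
  by apply/negP; rewrite -ltNge gtrBl.
Qed.

(** * Exchangeability and uniform ranks *)

Section iid.
Context d (T : measurableType d) (R : realType) (P : probability T R).
Variable X : nat -> {RV P >-> R}.
Hypothesis Xindep : mutually_independent X.
Hypothesis Xid : identically_distributed X.
Hypothesis Xcont : forall i, continuous (cdf (X i)).

Lemma iid_tuple n (s : n.-tuple nat) (A : 'I_n -> set R) : uniq s ->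
  (forall i, measurable (A i)) ->
  P [set w | forall i, A i (X (tnth s i) w)] =
  (\prod_(i < n) distribution P (X 0%N) (A i))%E.
Proof.
move=> us mA.
case: n s A us mA => [|n] s A us mA.
  by rewrite big_ord0 [X in P X](_ :
    _ = setT) ?probability_setT// -subTset => w _ [].
(* [mutually_independent] wants one set for every index; outside s the one supplied by [inord] is
   arbitrary. [inord] needs a nonempty ordinal, so n = 0 is treated apart. *)
pose B j := A (inord (index j s)).
have Bs i : B (tnth s i) = A i.
  rewrite /B (tnth_nth 0%N) index_uniq ?size_tuple//.
  by rewrite inord_val.
have := @Xindep [fset x in tval s]%fset B (fun=> mA _).
rewrite [X in P X](_ : _ = [set w | forall i, A i (X (tnth s i) w)]); last first.
  apply/seteqP; split => [w /= H i|w /= H j].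
    by rewrite -Bs; apply: H; rewrite /= inE mem_tnth.
  by rewrite /= inE => /tnthP[i ->]; rewrite /preimage/= Bs.
move=> ->; rewrite (perm_big (tval s)); last first.
  apply: uniq_perm => //; first exact: fset_uniq.
  by move=> j; rewrite inE.
rewrite -[in LHS](map_tnth_enum s) big_map big_enum/=.
by apply: eq_bigr => i _; rewrite Bs; exact: Xid.
Qed.

Lemma measurable_sample n (s : n.-tuple nat) :
  measurable_fun [set: T] (fun w => map_tuple (fun i => X i w) s).
Proof.
apply/measurable_fun_tnthP => i.
rewrite (_ : _ \o _ = X (tnth s i)); first exact: measurable_funPT.
by apply/funext => w /=; rewrite tnth_map.
Qed.

Let rectangles n : set (set (n.-tuple R)) :=
  [set E | exists2 A : 'I_n -> set R, (forall i, measurable (A i)) &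
           E = [set t | forall i, A i (tnth t i)]].

Lemma measurable_tupleE n :
  @measurable _ (n.-tuple R) = <<s @rectangles n >>.
Proof.
apply/seteqP; split; apply: smallest_sub; try exact: smallest_sigma_algebra.
- rewrite -bigcup_seq; apply: bigcup_sub => i _ _ [B mB <-].
  apply: sub_sigma_algebra; exists (fun j => if j == i then B else setT).
    by move=> j; case: ifP.
  apply/seteqP; split => [t [_ Bt] j|t /(_ i)]; first by case: eqP => [->|].
  by rewrite eqxx.
- move=> _ [A mA ->].
  rewrite [X in measurable X](_ : _ = \bigcap_(i in [set: 'I_n])
      ((fun t : n.-tuple R => tnth t i) @^-1` A i)); last first.
    by apply/seteqP; split => [t /= H i _|t /= H i]; exact: H.
  apply: fin_bigcap_measurable => // i _; rewrite -[X in measurable X]setTI.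
  exact: measurable_tnth.
Qed.

Lemma exchangeable n (s s' : n.-tuple nat) (E : set (n.-tuple R)) :
  uniq s -> uniq s' -> measurable E ->
  P [set w | E (map_tuple (fun i => X i w) s)] =
  P [set w | E (map_tuple (fun i => X i w) s')].
Proof.
move=> us us' mE.
pose Y (u : n.-tuple nat) : {mfun T >-> n.-tuple R} :=
  HB.pack (fun w => map_tuple (fun i => X i w) u)
    (isMeasurableFun.Build _ _ _ _ _ (measurable_sample u)).
have YE (u : n.-tuple nat) A : uniq u -> (forall i, measurable (A i)) ->
    distribution P (Y u) [set t | forall i, A i (tnth t i)] =
    (\prod_(i < n) distribution P (X 0%N) (A i))%E.
  move=> uu mA; rewrite -(iid_tuple uu mA); congr (P _).
  by apply/seteqP; split => w /= H i; have := H i; rewrite tnth_map.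
apply: (@measure_unique _ R _ (@rectangles n) (fun=> setT) (measurable_tupleE n)
  _ _ _ (distribution P (Y s)) (distribution P (Y s')) _ _ E mE).
- move=> _ _ [A mA ->] [B mB ->]; exists (fun i => A i `&` B i).
    by move=> i; exact: measurableI.
  by apply/seteqP; split => [t [/= a b] i|t /= ab]; [split|split => i;
    case: (ab i)].
- by move=> _; exists (fun=> setT) => //; apply/seteqP; split.
- by apply/seteqP; split => // t _; exists 0%N.
- by move=> _ [A mA ->]; exact: etrans (YE s A us mA) (esym (YE s' A us' mA)).
- by move=> k; rewrite (le_lt_trans (probability_le1 _ _)) ?ltry.
Qed.

(** The pair has the product law, for which the diagonal is null: its sections are points and the
    cdf is continuous. *)
Lemma iid_neq i j : i != j -> P [set w | X i w = X j w] = 0%E.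
Proof.
move=> ij.
pose Y : {mfun T >-> (R * R)%type} :=
  HB.pack (fun w => (X i w, X j w))
    (isMeasurableFun.Build _ _ _ _ _
      (measurable_fun_pair (measurable_funPT (X i)) (measurable_funPT (X j)))).
have mdiag : measurable [set xy : R * R | xy.1 = xy.2].
  rewrite (_ : mkset _ = (fun xy : R * R => xy.1 == xy.2) @^-1` [set true]).
    rewrite -[X in measurable X]setTI.
    exact: (@measurable_fun_eqr _ (R * R)%type R setT fst snd).
  by apply/seteqP; split => -[x y] /= /eqP.
have YE A B : measurable A -> measurable B ->
    distribution P Y (A `*` B) = (distribution P (X i) A *
      distribution P (X j) B)%E.
  move=> mA mB.
  have us : uniq [tuple i; j] by rewrite /= inE ij.
  pose F (k : 'I_2) := if k == 0%N :> nat then A else B.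
  have mF k : measurable (F k) by rewrite /F; case: ifP.
  transitivity (P [set w | forall k, F k (X (tnth ([tuple i; j]) k) w)]).
    congr (P _); apply/seteqP; split => [w [/= ? ?] k|w /= H]; last first.
      by split; [exact: (H ord0)|exact: (H (lift ord0 ord0))].
    by case: k => [[|[|[]]]] //= lk; rewrite (tnth_nth 0%N).
  rewrite (iid_tuple us mF) !big_ord_recl big_ord0 mule1.
  by rewrite (Xid i 0%N mA) (Xid j 0%N mB).
rewrite -[LHS](_ : distribution P Y [set xy | xy.1 = xy.2] = _)//.
rewrite -(@product_measure_unique _ _ _ _ _ (distribution P (X i))
  (distribution P (X j)) (distribution P Y) YE)//.
apply: integral0_eq => x _ /=.
rewrite [X in distribution P _ X](_ : _ = [set x]) ?continuous_cdf_set1//.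
by apply/seteqP; split => y /=; rewrite /xsection/= inE/=.
Qed.

Lemma measurable_count (I : eqType) (p : T -> pred I) (s : seq I) (j : nat) :
  (forall i, i \in s -> measurable [set w | p w i]) ->
  measurable [set w | count (p w) s = j].
Proof.
elim: s j => [|i s IH] j mp.
  case: j => [|j]; first by rewrite (_ : mkset _ = setT)//; apply/seteqP; split.
  by rewrite (_ : mkset _ = set0)//; apply/seteqP; split.
have mi : measurable [set w | p w i] by apply: mp; rewrite inE eqxx.
have ms k : measurable [set w | count (p w) s = k].
  by apply: IH => k' ks; apply: mp; rewrite inE ks orbT.
rewrite (_ : mkset _ = ([set w | p w i] `&` [set w | (count (p w) s).+1 = j]) `|`
                       (~` [set w | p w i] `&` [set w | count (p w) s = j])).
  apply: measurableU; apply: measurableI => //; last exact: measurableC.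
  case: j => [|j]; first by rewrite (_ : mkset _ = set0)//; apply/seteqP; split.
  rewrite (_ : mkset _ = [set w | count (p w) s = j])//.
  by apply/seteqP; split => w /=; [case|move=> ->].
apply/seteqP; split => w /=; last by move=> [] [] + <- => [->|/negP/negbTE ->].
by case: (p w i) => /= <-; [left|right].
Qed.

Let x w i := X i w.

Lemma measurable_ranking n j : measurable [set w | ranking (x w) n = j].
Proof.
rewrite /ranking /mkseq.
under eq_set do rewrite count_map.
apply: measurable_count => i _; rewrite /preim/=.
rewrite -[X in measurable X]setTI.
have := @measurable_fun_ler _ T R setT (X n) (X i) (measurable_funPT _)
  (measurable_funPT _).
by move=> /(_ measurableT [set true] _); apply.
Qed.

Lemma fine_partition (I : finType) (f : T -> I) (A : set T) : measurable A ->
  (forall i, measurable [set w | f w = i]) ->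
  fine (P A) = \sum_i fine (P (A `&` [set w | f w = i])).
Proof.
move=> mA mf.
rewrite sum_fine; last first.
  by move=> i _; rewrite fin_num_measure//; exact: measurableI.
rewrite fsbig_seq ?index_enum_uniq//.
rewrite -measure_fin_bigcup//.
- congr (fine (P _)); rewrite -setI_bigcupr setIidl// => w _.
  by exists (f w) => //=; rewrite mem_index_enum.
- by apply/trivIsetP => i j _ _ ij; apply/seteqP;
  split => // w /= [[_ ->] [_ /eqP]]; rewrite (negbTE ij).
- by move=> i _; exact: measurableI.
Qed.

Lemma ties_negligible :
  exists2 N, measurable N /\ P N = 0%E &
    forall w n, ~ N w -> uniq (mkseq (x w) n).
Proof.
have : P.-negligible (\bigcup_i \bigcup_j
    (if i == j then set0 else [set w | X i w = X j w])).
  apply: negligible_bigcup => i; apply: negligible_bigcup => j.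
  case: eqVneq => [_|ij]; first exact: negligible_set0.
  apply/negligibleP; last exact: iid_neq.
  rewrite (_ : mkset _ = (fun w => X i w == X j w) @^-1` [set true]).
    rewrite -[X in measurable X]setTI.
    by apply: (@measurable_fun_eqr _ T R setT (X i) (X j)).
  by apply/seteqP; split => w /= /eqP.
move=> [N [mN N0 sN]]; exists N => // w n Nw.
apply/(uniqP 0) => i j; rewrite !inE size_mkseq => iN jN.
rewrite !nth_mkseq// => xij; apply/eqP; apply: contra_notT Nw => ij.
by apply: sN; exists i => //; exists j => //; rewrite (negbTE ij).
Qed.

Lemma measure_eq_off A B N : measurable A -> measurable B -> measurable N ->
  P N = 0%E -> (forall w, ~ N w -> A w <-> B w) -> P A = P B.
Proof.
move=> mA mB mN N0 AB; rewrite -(measureU0 mA mN N0) -(measureU0 mB mN N0).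
congr (P _); apply/seteqP; split => w /= [H|]; try by right.
all: by have [|Nw] := pselect (N w); [right|left; apply/AB].
Qed.

Lemma measurable_rankings n (c : nat -> nat) :
  measurable [set w | forall i, (i < n)%N -> ranking (x w) i = c i].
Proof.
rewrite (_ : mkset _ = \bigcap_(i in [set i : 'I_n | true])
    [set w | ranking (x w) i = c i]).
  by apply: fin_bigcap_measurable => // i _; exact: measurable_ranking.
by apply/seteqP; split => [w /= H i _|w /= H i iN];
  [exact: H|exact: (H (Ordinal iN))].
Qed.

Lemma measurable_sorted n : measurable [set t : n.-tuple R | sorted >%R t].
Proof.
rewrite (_ : mkset _ = \bigcap_(ij in [set ij : 'I_n * 'I_n | (ij.1 < ij.2)%N])
    [set t : n.-tuple R | tnth t ij.2 < tnth t ij.1]).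
  apply: fin_bigcap_measurable => // -[i j] _; rewrite -[X in measurable X]setTI.
  have := @measurable_fun_ltr _ (n.-tuple R) R setT _ _ (measurable_tnth j)
    (measurable_tnth i).
  by move=> /(_ measurableT [set true] _); apply.
have tr : transitive (>%R : rel R) by move=> a b c ab /lt_trans; apply.
apply/seteqP; split => t /=; rewrite sorted_pairwise//.
  move=> /(pairwiseP 0) H [i j] /= ij.
  by have := H i j; rewrite !inE size_tuple !(tnth_nth 0); apply.
move=> H; apply/(pairwiseP 0) => i j; rewrite !inE size_tuple => iN jN ij.
by have := H (Ordinal iN, Ordinal jN) ij; rewrite /= !(tnth_nth 0).
Qed.

(** This is 1/n!, but only the ratio of consecutive values is used. *)
Let order_prob n := P [set w | sorted >%R (map (x w) (iota 0 n))].

Lemma rankings_prob n (c : nat -> nat) : (forall i, (c i <= i)%N) ->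
  P [set w | forall i, (i < n)%N -> ranking (x w) i = c i] = order_prob n.
Proof.
move=> cle; have [N [mN N0] HN] := ties_negligible.
have sz : size (rank_order c n) == n.
  by rewrite (perm_size (perm_rank_order c n)) size_iota.
have us : uniq (Tuple sz) by rewrite (perm_uniq (perm_rank_order c n)) iota_uniq.
have ui : uniq (iota_tuple n 0) by exact: iota_uniq.
have := exchangeable us ui (@measurable_sorted n).
rewrite /order_prob /= => <-; apply: (measure_eq_off _ _ mN N0).
- exact: measurable_rankings.
- have := measurable_sample (Tuple sz) measurableT (@measurable_sorted n).
  by rewrite setTI.
- move=> w /(HN w n) u; apply: iff_sym; exact: sorted_rank_order.
Qed.

Lemma order_probS n : fine (order_prob n) = n.+1%:R * fine (order_prob n.+1).
Proof.
rewrite -(@rankings_prob n (fun=> 0%N))//.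
have rle w : (ranking (x w) n < n.+1)%N.
  by rewrite ltnS /ranking (leq_trans (count_size _ _))// size_mkseq.
rewrite (@fine_partition _ (fun w => inord (ranking (x w) n) : 'I_n.+1)).
- rewrite (eq_bigr (fun=> fine (order_prob n.+1))); last first.
    move=> j _; rewrite -(@rankings_prob n.+1 (fun i => if (i < n)%N then 0
      else minn i j)%N).
      congr (fine (P _)); apply/seteqP; split => w /=.
        move=> [H rj] i; rewrite ltnS leq_eqVlt => /orP[/eqP ->|iN];
          last by rewrite iN H.
        by rewrite ltnn -rj inordK// (minn_idPr _)// -ltnS.
      move=> H; split=> [i iN|]; first by have := H i; rewrite iN ltnS ltnW//;
        apply.
      apply/val_inj; rewrite /= inordK// H// ltnn (minn_idPr _)// -ltnS//.
    by move=> i; case: ifP => // _; exact: geq_minl.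
  by rewrite sumr_const card_ord mulr_natl.
- exact: measurable_rankings.
- move=> j; rewrite (_ : mkset _ = [set w | ranking (x w) n = j]);
  first exact: measurable_ranking.
  apply/seteqP; split => w /=; first by move=> <-; rewrite inordK.
  by move=> H; apply/val_inj; rewrite /= inordK.
Qed.

Lemma ranking_le w n : (ranking (x w) n <= n)%N.
Proof. by rewrite /ranking (leq_trans (count_size _ _))// size_mkseq. Qed.

Lemma measurable_ranking_lt n j : measurable [set w | (ranking (x w) n < j)%N].
Proof.
rewrite (_ : mkset _ = \bigcup_(i in [set i : 'I_j | true])
    [set w | ranking (x w) n = i]).
  by apply: fin_bigcup_measurable => // i _; exact: measurable_ranking.
by apply/seteqP; split => [w /= H|w [i _ /= ->]]; [exists (Ordinal H)|].
Qed.

Lemma rankings_lt_prob n (c : nat -> nat) j : (forall i, (c i <= i)%N) ->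
  (j <= n.+1)%N ->
  fine (P [set w | (forall i, (i < n)%N -> ranking (x w) i = c i) /\
                   (ranking (x w) n < j)%N]) = j%:R * fine (order_prob n.+1).
Proof.
move=> cle jn.
rewrite (@fine_partition _ (fun w => inord (ranking (x w) n) : 'I_n.+1)).
- transitivity (\sum_(i < n.+1) if (i < j)%N then fine (order_prob n.+1) else 0).
    apply: eq_bigr => i _; case: ifPn => ij.
      rewrite -(@rankings_prob n.+1 (fun k => if (k < n)%N then c k else minn k
        i)%N).
        congr (fine (P _)); apply/seteqP; split => w /=.
          move=> [[H _] rj] k; rewrite ltnS leq_eqVlt => /orP[/eqP ->|kN];
            last by rewrite kN H.
          by rewrite ltnn -rj inordK ?ltnS ?ranking_le// (minn_idPr _)// ranking_le.
        move=> H; have rn : ranking (x w) n = i.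
          by rewrite H// ltnn (minn_idPr _)// -ltnS.
        split; first split=> [k kN|]; first by have := H k;
          rewrite kN ltnS ltnW//; apply.
          by rewrite rn.
        by apply/val_inj; rewrite /= inordK rn.
      by move=> k; case: ifP => // _; exact: geq_minl.
    rewrite [X in P X](_ : _ = set0) ?measure0//.
    apply/seteqP; split => // w /= [[_ rj] ri]; move: ij.
    by rewrite -ri inordK ?rj// ltnS ranking_le.
  rewrite -big_mkcond/= -(big_ord_widen n.+1 (fun=> fine (order_prob n.+1)) jn).
  by rewrite sumr_const card_ord mulr_natl.
- by apply: measurableI; [exact: measurable_rankings|exact: measurable_ranking_lt].
- move=> i; rewrite (_ : mkset _ = [set w | ranking (x w) n = i]);
  first exact: measurable_ranking.
  apply/seteqP; split => w /=; first by move=> <-; rewrite inordK ?ltnS ?ranking_le.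
  by move=> H; apply/val_inj; rewrite /= inordK ?ltnS ?ranking_le.
Qed.

Let prefix n w : {ffun 'I_n -> 'I_n.+1} :=
  [ffun i : 'I_n => inord (ranking (x w) i)].

(** The default 0 past n respects the bound c i <= i that [rankings_prob] asks of every index. *)
Let of_prefix n (c : {ffun 'I_n -> 'I_n.+1}) (i : nat) : nat :=
  if insub i is Some k then c k else 0%N.

Lemma prefixE n w (c : {ffun 'I_n -> 'I_n.+1}) :
  prefix n w = c <-> forall i, (i < n)%N -> ranking (x w) i = of_prefix c i.
Proof.
have ri i : (i < n)%N -> (ranking (x w) i < n.+1)%N.
  by move=> iN; rewrite ltnS (leq_trans (ranking_le w i))// ltnW.
split=> [<- i iN|H]; first by rewrite /of_prefix insubT/= ffunE/= inordK// ri.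
apply/ffunP => i; apply/val_inj; rewrite ffunE /= inordK ?ri// H//.
by rewrite /of_prefix insubT//= => iN; congr (nat_of_ord (c _)); exact/val_inj.
Qed.

(** Stands for measurability with respect to the first n ranks. *)
Definition depends_below A (n : nat) (Q : (nat -> nat) -> A) :=
  forall c c', (forall i, (i < n)%N -> c i = c' i) -> Q c = Q c'.

Lemma measurable_prefix n c : measurable [set w | prefix n w = c].
Proof.
rewrite (_ : mkset _ = [set w | forall i, (i < n)%N ->
  ranking (x w) i = of_prefix c i]).
  exact: measurable_rankings.
by apply/seteqP; split => w /=; rewrite prefixE.
Qed.

Lemma measurable_depends_below n (Q : (nat -> nat) -> bool) :
  depends_below n Q -> measurable [set w | Q (ranking (x w))].
Proof.
move=> Qn.
rewrite (_ : mkset _ = \bigcup_(c in [set c | Q (of_prefix c)]) [set w | prefix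
  n w = c]).
  by apply: fin_bigcup_measurable => // c _; exact: measurable_prefix.
apply/seteqP; split => w /=.
  move=> Qw; exists (prefix n w) => //=; rewrite -(Qn (ranking (x w)))//.
  exact/prefixE.
by move=> [c /= Qc /prefixE H]; rewrite (Qn _ _ H).
Qed.

(** On each admissible prefix of ranks the n + 1 values of the next rank are equally likely, and Q
    is a finite union of prefixes. Prefixes violating c i <= i are empty events. *)
Lemma ranking_indep n (Q : (nat -> nat) -> bool) j : depends_below n Q ->
  (j <= n.+1)%N ->
  fine (P [set w | Q (ranking (x w)) /\ (ranking (x w) n < j)%N]) =
  j%:R / n.+1%:R * fine (P [set w | Q (ranking (x w))]).
Proof.
move=> Qn jn; have mQ := measurable_depends_below Qn.
rewrite (@fine_partition _ (prefix n)); first last.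
- exact: measurable_prefix.
- by apply: measurableI => //; exact: measurable_ranking_lt.
rewrite (@fine_partition _ (prefix n) [set w | Q _])//;
  last exact: measurable_prefix.
rewrite mulr_sumr; apply: eq_bigr => c _.
have [cle|] := boolP [forall i : 'I_n, (c i <= i)%N]; last first.
  rewrite negb_forall => /existsP[i]; rewrite -ltnNge => ic.
  have E : [set w | prefix n w = c] = set0.
    apply/seteqP; split => // w /=/prefixE/(_ i (ltn_ord i)) H.
    by have := ranking_le w i; rewrite H /of_prefix (valK i) leqNgt ic.
  by rewrite E !setI0 measure0 mulr0.
have cle' i : (of_prefix c i <= i)%N.
  rewrite /of_prefix; case: insubP => //= k _ <-.
  exact: (forallP cle k).
have [Qc|Qc] := boolP (Q (of_prefix c)); last first.
  rewrite [X in P X](_ : _ = set0); last first.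
    by apply/seteqP; split => // w /= [[+ _] /prefixE/Qn H]; rewrite H (negbTE Qc).
  rewrite [X in _ = _ * fine (P X)](_ : _ = set0) ?measure0 ?mulr0//.
  by apply/seteqP; split => // w /= [+ /prefixE/Qn H]; rewrite H (negbTE Qc).
rewrite [X in P X](_ : _ = [set w | (forall i, (i < n)%N ->
  ranking (x w) i = of_prefix c i) /\
                   (ranking (x w) n < j)%N]); last first.
  apply/seteqP; split => w /=; first by move=> [[_ ?] /prefixE].
  by move=> [H ?]; rewrite prefixE (Qn _ _ H).
rewrite rankings_lt_prob//.
rewrite [X in _ = _ * fine (P X)](_ : _ = [set w | (forall i, (i < n)%N ->
  ranking (x w) i = of_prefix c i)]); last first.
  apply/seteqP; split => w /=; first by move=> [_ /prefixE].
  by move=> H; rewrite prefixE (Qn _ _ H).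
by rewrite rankings_prob// (order_probS n) [RHS]mulrA divfK// pnatr_eq0.
Qed.

(** * The Markov property of the accepted count *)

Variable r : nat -> nat.
Hypothesis rP : rank_sequence r.

Lemma hired_le (c : nat -> nat) n : (hired r c n <= n)%N.
Proof. by elim: n => [//|n IH] /=; rewrite -[n.+1]addn1 leq_add// leq_b1. Qed.

Lemma hired_depends_below n : depends_below n (fun c => hired r c n).
Proof.
elim: n => [//|n IH] c c' cc /=; rewrite (IH c c') ?cc//.
by move=> i iN; rewrite cc// ltnS ltnW.
Qed.

Let hired_prob (Q : (nat -> nat) -> bool) n m : R :=
  fine (P [set w | Q (ranking (x w)) && (hired r (ranking (x w)) n == m)]).

(** The forward equation tested against W, restricted to an event Q of the past: this is the
    hypothesis [muS] of the chain. *)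
Lemma hired_probS (Q : (nat -> nat) -> bool) n (W : nat -> R) :
  depends_below n Q ->
  \sum_(m < n.+2) hired_prob Q n.+1 m * W m =
  \sum_(m < n.+1) hired_prob Q n m *
     ((1 - (r m)%:R / n.+1%:R) * W m + (r m)%:R / n.+1%:R * W m.+1).
Proof.
move=> Qn.
have Qm m : depends_below n (fun c => Q c && (hired r c n == m)).
  by move=> c c' cc; rewrite (Qn _ _ cc) (hired_depends_below cc).
have mQ m := measurable_depends_below (Qm m).
have rn m : (m < n.+1)%N -> (r m <= n.+1)%N.
  by move=> mn; rewrite (leq_trans (rank_sequence_le m rP)).
pose J m := fine (P [set w | Q (ranking (x w)) && (hired r (ranking (x w)) n ==
  m) /\
                             (ranking (x w) n < r m)%N]).
have JE m : (m < n.+1)%N -> J m = (r m)%:R / n.+1%:R * hired_prob Q n m.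
  by move=> mn; rewrite /J (ranking_indep (Qm m) (rn _ mn)).
(* State m' is reached from m' by a rejection or from m' - 1 by an acceptance; [J m] is the accepted
   part of the mass at m. *)
have step (m' : nat) : hired_prob Q n.+1 m' =
    \sum_(m < n.+1) ((m' == m)%:R * (hired_prob Q n m - J m) +
      (m' == m.+1)%:R * J m).
  rewrite /hired_prob (@fine_partition _ (fun w => inord (hired r (ranking (x
    w)) n) : 'I_n.+1)).
  - apply: eq_bigr => m _.
    have mJ : measurable [set w | Q (ranking (x w)) && (hired r (ranking (x w))
      n == m) /\
                             (ranking (x w) n < r m)%N].
      by apply: measurableI; [exact: mQ|exact: measurable_ranking_lt].
    have -> : hired_prob Q n m - J m = fine (P ([set w | Q (ranking (x w)) &&
      (hired r (ranking (x w)) n == m)] `\` [set w | Q (ranking (x w)) &&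
        (hired r (ranking (x w)) n == m) /\
                             (ranking (x w) n < r m)%N])).
      rewrite measureD//; last by rewrite ltey_eq fin_num_measure.
      rewrite fineB ?fin_num_measure//; last exact: measurableI.
      by rewrite setIidr// => w [].
    have fib w : (inord (hired r (ranking (x w)) n) = m) <-> hired r (ranking
      (x w)) n = m.
      split=> [<-|H]; first by rewrite inordK// ltnS hired_le.
      by apply/val_inj; rewrite /= inordK// ltnS hired_le.
    have [->|m'm] := eqVneq m' m.
      rewrite mul1r (_ : (m == m.+1 :> nat) = false); last by rewrite ltn_eqF.
      rewrite mul0r addr0; congr (fine (P _)); apply/seteqP; split => w /=.
        move=> [/andP[Qw +] /fib hm];
          rewrite hm -[X in _ == X]addn0 eqn_add2l => /eqP/eqP.
        by rewrite eqb0 => rj; rewrite Qw eqxx; split => // -[_]; apply/negP.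
      move=> [/andP[Qw /eqP hm] H]; split; last exact/fib.
      rewrite Qw hm /= -[X in _ == X]addn0 eqn_add2l eqb0; apply/negP => H';
        apply: H.
      by rewrite Qw hm eqxx.
    rewrite mul0r add0r.
    have [->|m'm1] := eqVneq m' m.+1.
      rewrite mul1r; congr (fine (P _)); apply/seteqP; split => w /=.
        move=> [/andP[Qw +] /fib hm]; rewrite hm -[m.+1]addn1 eqn_add2l => /eqP/eqP.
        by rewrite eqb1 => rj; rewrite Qw eqxx.
      move=> [/andP[Qw /eqP hm] H]; split; last exact/fib.
      by rewrite Qw hm H addn1 eqxx.
    rewrite mul0r [X in P X](_ : _ = set0) ?measure0//.
    apply/seteqP; split => // w /= [/andP[_ /eqP mw] /fib hm]; move: mw m'm m'm1.
    by rewrite hm => <-; case: (_ < _)%N; rewrite ?addn0 ?addn1 eqxx.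
  - apply: (@measurable_depends_below n.+1 (fun c => Q c && (hired r c n.+1 ==
    m'))).
    move=> c c' cc; rewrite (hired_depends_below cc) (Qn c c')// => i iN.
    by rewrite cc// ltnS ltnW.
  - move=> i.
    rewrite (_ : mkset _ = [set w | hired r (ranking (x w)) n == i]).
      apply: (@measurable_depends_below n (fun c => hired r c n == i)) => c c' cc.
      by rewrite (hired_depends_below cc).
    apply/seteqP; split => w /=; first by move=> <-; rewrite inordK// ltnS hired_le.
    by move=> /eqP H; apply/val_inj; rewrite /= inordK ?H// ltnS.
under eq_bigr do rewrite step mulr_suml.
rewrite exchange_big/=; apply: eq_bigr => m _.
under eq_bigr do rewrite mulrDl -!mulrA.
rewrite big_split/=.
have pick (k : nat) (a : R) : (k < n.+2)%N ->
    \sum_(i < n.+2) (i == k :> nat)%:R * (a * W i) = a * W k.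
  move=> kn; rewrite (bigD1 (Ordinal kn))//= eqxx mul1r big1 ?addr0// => i.
  by rewrite -val_eqE /= => /negbTE ->; rewrite mul0r.
have mn := ltn_ord m; have mn2 : (m < n.+2)%N by exact: ltnW.
rewrite !pick ?JE//.
by ring.
Qed.

End iid.

(** * Mixing *)

Section renyi.
Context d (T : measurableType d) (R : realType) (P : probability T R).
Local Notation pr A := (fine (P A)).

Lemma pr_ge0 A : 0 <= pr A. Proof. exact: fine_ge0. Qed.

Lemma pr_le1 A : measurable A -> pr A <= 1.
Proof. by move=> mA; rewrite -lee_fin fineK ?fin_num_measure// probability_le1. Qed.

(** The sum is the mean of the square of sum_i a i 1_(E i), computed on the finitely many atoms
    generated by the E i. *)
Lemma gram_psd (I : finType) (E : I -> set T) (a : I -> R) :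
  (forall i, measurable (E i)) ->
  0 <= \sum_i \sum_j a i * a j * pr (E i `&` E j).
Proof.
move=> mE; pose f w : {ffun I -> bool} := [ffun i => `[< E i w >]].
have fE (c : {ffun I -> bool}) : [set w | f w = c] =
    \bigcap_(i in [set i : I | true]) (if c i then E i else ~` E i).
  apply/seteqP; split => [w <- i _|w H]; first by rewrite ffunE; case: asboolP.
  apply/ffunP => i; rewrite ffunE; have := H i isT.
  by case: (c i) => Ei; [apply/asboolP|apply/asboolPn].
have mf (c : {ffun I -> bool}) : measurable [set w | f w = c].
  rewrite fE; apply: fin_bigcap_measurable => // i _.
  by case: (c i) => //; exact: measurableC.
pose q (c : {ffun I -> bool}) := pr [set w | f w = c].
have EE i j : pr (E i `&` E j) = \sum_(c : {ffun I ->
  bool}) (c i)%:R * (c j)%:R * q c.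
  rewrite (fine_partition P (measurableI _ _ (mE i) (mE j)) mf).
  apply: eq_bigr => c _; have [ci|ci] := boolP (c i); last first.
    rewrite !mul0r [X in P X](_ : _ = set0) ?measure0//.
    by apply/seteqP; split => // w [[Ei _] /= fw]; move/negP : ci; apply;
      rewrite -fw ffunE; apply/asboolP.
  have [cj|cj] := boolP (c j); last first.
    rewrite mulr0 mul0r [X in P X](_ : _ = set0) ?measure0//.
    by apply/seteqP; split => // w [[_ Ej] /= fw]; move/negP : cj; apply;
      rewrite -fw ffunE; apply/asboolP.
  rewrite !mul1r; congr (fine (P _)); apply/seteqP; split => w; first by case.
  move=> /= fw; split=> //; move: ci cj; rewrite -fw !ffunE.
  by move=> /asboolP ? /asboolP ?.
have -> : \sum_i \sum_j a i * a j * pr (E i `&` E j) =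
    \sum_(c : {ffun I -> bool}) q c * (\sum_i a i * (c i)%:R) ^+ 2.
  under eq_bigr => i _.
    under eq_bigr => j _ do rewrite EE mulr_sumr.
    rewrite exchange_big/=.
    over.
  rewrite exchange_big/=; apply: eq_bigr => c _.
  rewrite expr2 mulr_suml mulr_sumr; apply: eq_bigr => i _.
  by rewrite mulr_sumr mulr_sumr; apply: eq_bigr => j _; ring.
by apply: sumr_ge0 => c _; rewrite mulr_ge0 ?sqr_ge0// pr_ge0.
Qed.

Lemma gram_psd_seq (s : seq (R * set T)) : (forall x, x \in s -> measurable x.2) ->
  0 <= \sum_(x <- s) \sum_(y <- s) x.1 * y.1 * pr (x.2 `&` y.2).
Proof.
move=> ms; have := @gram_psd _ (fun i => (tnth (in_tuple s) i).2)
  (fun i => (tnth (in_tuple s) i).1) (fun i => ms _ (mem_tnth i (in_tuple s))).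
rewrite [X in _ -> 0 <= X]big_tnth.
by under [X in _ -> 0 <= X]eq_bigr do rewrite big_tnth.
Qed.

Variables (E : nat -> set T) (p : R).
Hypothesis mE : forall n, measurable (E n).
Hypothesis p01 : 0 <= p <= 1.

(** Centred at the limit p and not at pr (E i): the mean of (1_(E i) - p) (1_(E j) - p). *)
Let cov i j : R := pr (E i `&` E j) - p * pr (E i) - p * pr (E j) + p ^+ 2.

Let covC i j : cov i j = cov j i.
Proof. by rewrite /cov setIC; ring. Qed.

Let cov_le1 i : cov i i <= 1.
Proof.
rewrite /cov setIid; have := pr_ge0 (E i); have := pr_le1 (mE i).
case/andP: p01 => p0 p1; move: (pr (E i)) => x x1 x0.
have : p * p <= 1 * p by rewrite ler_wpM2r.
have : 0 <= p * x by rewrite mulr_ge0.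
have : 0 <= (1 - x) * (1 - p) by rewrite mulr_ge0// subr_ge0.
have : x * p <= 1 * p by rewrite ler_wpM2r.
rewrite expr2; lra.
Qed.

Let cov_sum_le (a : nat -> R) (dl : R) (s : seq nat) : 0 <= dl ->
  (forall i, `|a i| <= 1) -> pairwise (fun i j => `|cov i j| <= dl) s ->
  \sum_(i <- s) \sum_(j <- s) a i * a j * cov i j <=
  (size s)%:R + (size s)%:R ^+ 2 * dl.
Proof.
move=> dl0 a1; elim: s => [|n s IH] /=;
  first by rewrite big_nil addr_ge0// mulr_ge0// exprn_ge0.
move=> /andP[/allP ns /IH {}IH]; rewrite !big_cons.
under [X in _ + X <= _]eq_bigr do rewrite big_cons.
rewrite big_split/=.
have cross : \sum_(j <- s) a n * a j * cov n j <= (size s)%:R * dl.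
  apply: le_trans (_ : \sum_(j <- s) dl <= _); last first.
    by rewrite big_const_seq count_predT iter_addr_0 mulr_natl.
  rewrite big_seq [leRHS]big_seq; apply: ler_sum => j /ns njd.
  apply: le_trans (ler_norm _) _; rewrite !normrM -[leRHS]mul1r ler_pM//.
  by rewrite -[leRHS]mul1r ler_pM.
have -> : \sum_(i <- s) a i * a n * cov i n = \sum_(j <- s) a n * a j * cov n j.
  by apply: eq_bigr => i _; rewrite covC; ring.
have diag : a n * a n * cov n n <= 1.
  have an : 0 <= a n * a n <= 1.
    rewrite -expr2 sqr_ge0/= -real_normK ?num_real// exprn_ile1//.
  have : a n * a n * cov n n <= a n * a n * 1 by rewrite ler_wpM2l//; case/andP: an.
  by case/andP: an; lra.
move: (\sum_(j <- s) _) (\sum_(i <- s) \sum_(j <- s) _) cross IH diag => C D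
  cross IH diag.
rewrite -natr1; move: cross IH; set M := (size s)%:R => cross IH; lra.
Qed.

(** Expansion of the nonnegative mean square of sum_i a i (1_(E i) - p) - l 1_B, with pr B <= 1; the
    constant -p sum_i a i is carried by the full event [setT]. *)
Let cov_cauchy_schwarz (a : nat -> R) (B : set T) (l : R) (s : seq nat) :
  measurable B ->
  2 * l * \sum_(i <- s) a i * (pr (B `&` E i) - p * pr B) <=
  \sum_(i <- s) \sum_(j <- s) a i * a j * cov i j + l ^+ 2.
Proof.
move=> mB; pose A := \sum_(i <- s) a i.
pose u := \sum_(i <- s) a i * pr (E i); pose v :=
  \sum_(i <- s) a i * pr (B `&` E i).
pose Q := \sum_(i <- s) \sum_(j <- s) a i * a j * pr (E i `&` E j).
have -> : \sum_(i <- s) a i * (pr (B `&` E i) - p * pr B) = v - p * pr B * A.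
  under eq_bigr do rewrite mulrBr; rewrite sumrB -/v; congr (_ - _).
  by rewrite -mulr_suml mulrC.
have -> : \sum_(i <- s) \sum_(j <- s) a i * a j * cov i j = Q - 2 * p * A * u +
  p ^+ 2 * A ^+ 2.
  transitivity (\sum_(i <- s) (\sum_(j <- s) a i * a j * pr (E i `&` E j)
      - p * A * (a i * pr (E i)) - p * a i * u + p ^+ 2 * A * a i)).
    apply: eq_bigr => i _; rewrite /A /u.
    rewrite !mulr_sumr !mulr_suml -!sumrB -big_split/=; apply: eq_bigr => j _.
    by rewrite /cov; ring.
  rewrite big_split/= !sumrB -/Q -!mulr_sumr -/u -/A -mulr_suml.
  rewrite -[X in _ - X * u]mulr_sumr -/A; ring.
have ms x : x \in [:: (- l, B), (- (p * A), setT) & [seq (a i, E i) | i <- s]] ->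
    measurable x.2.
  by rewrite !inE => /or3P[/eqP ->|/eqP ->|/mapP[i _ ->]];
    [|exact: measurableT|exact: mE].
have := gram_psd_seq ms; set G := \sum_(x <- _) _.
have -> : G = l ^+ 2 * pr B - 2 * l * (v - p * pr B * A)
    + (Q - 2 * p * A * u + p ^+ 2 * A ^+ 2).
  rewrite /G !big_cons !big_map /=.
  under [X in _ + (_ + X) = _]eq_bigr do rewrite !big_cons big_map /=.
  rewrite !big_split/= -/Q setIid setTI !setIT probability_setT /=.
  have -> : \sum_(j <- s) - l * a j * pr (B `&` E j) = - l * v.
    by rewrite [RHS]mulr_sumr; apply: eq_bigr => j _; rewrite mulrA.
  have -> : \sum_(j <- s) - (p * A) * a j * pr (setT `&` E j) = - (p * A) * u.
    by rewrite [RHS]mulr_sumr; apply: eq_bigr => j _; rewrite setTI mulrA.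
  have -> : \sum_(i <- s) a i * - l * pr (E i `&` B) = - l * v.
    by rewrite [RHS]mulr_sumr; apply: eq_bigr => j _; rewrite setIC; ring.
  have -> : \sum_(i <- s) a i * - (p * A) * pr (E i `&` setT) = - (p * A) * u.
    by rewrite [RHS]mulr_sumr; apply: eq_bigr => j _; rewrite setIT; ring.
  ring.
have : l ^+ 2 * pr B <= l ^+ 2 * 1 by rewrite ler_wpM2l ?sqr_ge0 ?pr_le1.
lra.
Qed.

(* Covariances with a fixed [E k] vanish, so [M] well-separated indices behave
   as an almost orthogonal family; if all of them had a correlation at least [e]
   with [B], Cauchy-Schwarz would bound [(M e)^2] by about [M]. *)
Lemma renyi_mixing (B : set T) : measurable B ->
  (forall k, pr (E k `&` E n) @[n --> \oo] --> pr (E k) * p) ->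
  pr (E n) @[n --> \oo] --> p ->
  pr (B `&` E n) @[n --> \oo] --> pr B * p.
Proof.
move=> mB mix cvgE; apply: contrapT => ncvg.
pose c n := pr (B `&` E n) - p * pr B.
have [e e0 eP] : exists2 e, 0 < e & forall N, exists2 n, (N <= n)%N & e <= `|c n|.
  apply: contrapT => H; apply: ncvg; apply/cvgrPdist_lt => e e0.
  apply: contrapT => H'; apply: H; exists e => // N.
  apply: contrapT => H''; apply: H'; exists N => // n /= Nn.
  rewrite ltNge; apply/negP => en; apply: H''; exists n => //.
  by rewrite /c distrC [p * _]mulrC.
have e20 : 0 < e ^+ 2 by rewrite exprn_gt0.
pose dl := e ^+ 2 / 4.
have dl0 : 0 < dl by rewrite divr_gt0.
have cov0 k : cov k n @[n --> \oo] --> (0 : R).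
  have -> : 0 = pr (E k) * p - p * pr (E k) - p * p + p ^+ 2 by ring.
  apply: cvgD; last exact: cvg_cst.
  apply: cvgB; first by apply: cvgB => //; exact: cvg_cst.
  by apply: cvgM => //; exact: cvg_cst.
have step : forall M, exists s : seq nat, [/\ size s = M,
    pairwise (fun i j => `|cov i j| <= dl) s & forall i, i \in s -> e <= `|c i|].
  elim=> [|M [s [sM sP sc]]]; first by exists [::].
  have : \forall n \near \oo, all (fun i => `|cov i n| <= dl) s.
    elim: s {sM sP sc} => [|i s IH]; first exact: nearW.
    move/cvgrPdist_le : (cov0 i) => /(_ _ dl0); apply: filterS2 IH => n sn.
    by rewrite sub0r normrN /= => ->.
  move=> [N _ NP]; have [n Nn en] := eP N.
  exists (n :: s); split => /=; first by rewrite sM.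
    by rewrite sP andbT; apply/allP => i is_; rewrite covC; exact: (allP (NP n Nn)).
  by move=> i; rewrite inE => /predU1P[->|/sc].
(* With a i the sign of c i and l = M e, the bounds give 2 (M e)^2 <= M + (M e)^2 / 4 + (M e)^2,
   hence M e^2 <= 4/3, against M e^2 > 2. *)
pose M := (Num.truncn (2 / e ^+ 2)).+1.
have [s [sM sP sc]] := step M.
have M2 : 2 < M%:R * e ^+ 2 by rewrite -ltr_pdivrMr// truncnS_gt.
have a1 i : `|Num.sg (c i)| <= 1 by rewrite normr_sg lern1 leq_b1.
have cs := cov_cauchy_schwarz (fun i => Num.sg (c i)) (M%:R * e) s mB.
have ub := cov_sum_le (ltW dl0) a1 sP; rewrite sM in ub.
have lb : M%:R * e <= \sum_(i <- s) Num.sg (c i) * (pr (B `&` E i) - p * pr B).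
  rewrite -sM mulr_natl -[leLHS]addr0 -iter_addr -count_predT -big_const_seq.
  rewrite big_seq [leRHS]big_seq; apply: ler_sum => i /sc.
  by rewrite -/(c i) -normrEsg.
have M0 : (0 : R) < M%:R by [].
have Me0 : 0 <= M%:R * e by rewrite mulr_ge0// ltW.
have := ler_wpM2l Me0 lb.
have : M%:R * 2 < M%:R * (M%:R * e ^+ 2) by rewrite ltr_pM2l.
move: cs ub; rewrite /dl; move: (\sum_(i <- s) \sum_(j <- s) _) => D.
move: (\sum_(i <- s) _) => S cs ub h1 h2.
have : 0 < M%:R * (M%:R * e ^+ 2) by rewrite !mulr_gt0.
lra.
Qed.
End renyi.

(** * Back to the hiring process *)

Section hiring_limit.
Context (R : realType) (d : measure_display) (T : measurableType d).
Variables (P : probability T R) (X : nat -> {RV P >-> R}).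
Hypothesis Xindep : mutually_independent X.
Hypothesis Xid : identically_distributed X.
Hypothesis Xcont : forall i, continuous (cdf (X i)).
Variable r : nat -> nat.
Hypothesis rP : rank_sequence r.
Hypothesis rRV : regularly_varying (fun m => (r m)%:R : R).
Hypothesis rdiv : (\sum_(0 <= m <oo) ((r m)%:R ^- 2 : R)%:E)%E = +oo%E.
Variable mu : nat -> R.
Hypothesis muP : (fun n => \sum_(1 <= k < (Num.truncn (mu n)).+1) (r k)%:R^-1) =
         (fun n => ln n%:R) +O_\oo (fun=> 1 : R).
Variable t : R.

Let gam n : R := beta r (Num.truncn (mu n)).
Let N n := (Num.truncn (mu n + t * gam n)).+1.
Let x w i := X i w.
Let E n := [set w | (hired r (ranking (x w)) n < N n)%N].

Let measurable_E n : measurable (E n).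
Proof.
apply: (@measurable_depends_below _ _ _ _ X n (fun c => hired r c n < N n)%N).
by move=> c c' cc; rewrite (hired_depends_below r cc).
Qed.

(** An event Q of the past enters [chain_clt] as an unnormalized starting mass at time k, so the
    limit carries its total mass. *)
Lemma hired_limit k (Q : (nat -> nat) -> bool) : depends_below k Q ->
  fine (P ([set w | Q (ranking (x w))] `&` E n)) @[n --> \oo] -->
  fine (P [set w | Q (ranking (x w))]) * normal_cdf t.
Proof.
move=> Qk; have mQ := measurable_depends_below X Qk.
pose m n j := fine (P [set w | Q (ranking (x w)) && (hired r (ranking (x w)) n
  == j)]).
have Qn n : (k <= n)%N -> depends_below n Q.
  by move=> kn c c' cc; apply: Qk => i ik; apply: cc; exact: leq_trans kn.
have mS n (W : nat -> R) : (k <= n)%N ->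
  \sum_(j < n.+2) m n.+1 j * W j =
  \sum_(j < n.+1) m n j *
     ((1 - (r j)%:R / n.+1%:R) * W j + (r j)%:R / n.+1%:R * W j.+1).
  by move=> kn; exact: (hired_probS Xindep Xid Xcont rP W (Qn n kn)).
have m_ge0 n j : 0 <= m n j by exact: fine_ge0.
have mfib n (j : 'I_n.+1) :
  measurable [set w | (inord (hired r (ranking (x w)) n) : 'I_n.+1) = j].
  rewrite (_ : mkset _ = [set w | hired r (ranking (x w)) n == j]).
    apply: (@measurable_depends_below _ _ _ _ X n (fun c => hired r c n == j)).
    by move=> c c' cc; rewrite (hired_depends_below r cc).
  apply/seteqP; split => w /=; first by move=> <-; rewrite inordK// ltnS hired_le.
  by move=> /eqP H; apply/val_inj; rewrite /= inordK H.
have fib n (j : 'I_n.+1) w :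
  (inord (hired r (ranking (x w)) n) = j) <-> hired r (ranking (x w)) n = j.
  split=> [<-|H]; first by rewrite inordK// ltnS hired_le.
  by apply/val_inj; rewrite /= inordK// ltnS hired_le.
have split_Q n : fine (P [set w | Q (ranking (x w))]) = \sum_(j < n.+1) m n j.
  rewrite (fine_partition P mQ (mfib n)); apply: eq_bigr => j _.
  congr (fine (P _)); apply/seteqP; split => w /=.
    by move=> [-> /fib ->]; rewrite eqxx.
  by move=> /andP[-> /eqP H]; split => //; exact/fib.
have split_E n : fine (P ([set w | Q (ranking (x w))] `&` E n)) =
    \sum_(j < n.+1 | (j < N n)%N) m n j.
  rewrite (fine_partition P (measurableI _ _ mQ (measurable_E n)) (mfib n)).
  rewrite [RHS]big_mkcond/=; apply: eq_bigr => j _; case: ifPn => jN.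
    congr (fine (P _)); apply/seteqP; split => w /=.
      by move=> [[-> _] /fib ->]; rewrite eqxx.
    by move=> /andP[-> /eqP H]; split; [by split => //; rewrite /E /= H|exact/fib].
  rewrite [X in P X](_ : _ = set0) ?measure0//.
  apply/seteqP; split => // w /= [[_ +] /fib H]; rewrite /E /= H.
  by apply/negP.
rewrite (split_Q k); under eq_cvg do rewrite split_E.
apply: (chain_clt rP m_ge0 mS (sd_y rP rdiv muP)).
- exact: (threshold_sum_cvg rP rRV rdiv muP).
- exact: (threshold_sum2_cvg rP rRV rdiv muP).
Qed.

(** E k depends on the first k ranks only, so [hired_limit] applied to the event E k gives the
    vanishing covariances that [renyi_mixing] asks for. *)
Lemma hired_mixing (B : set T) : measurable B ->
  fine (P (B `&` E n)) @[n --> \oo] --> fine (P B) * normal_cdf t.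
Proof.
move=> mB; have ET : fine (P (E n)) @[n --> \oo] --> normal_cdf t.
  have := @hired_limit 0 (fun=> true) (fun _ _ _ => erefl).
  rewrite (_ : mkset _ = setT); last exact/seteqP.
  rewrite probability_setT mul1r.
  by under eq_cvg do rewrite setTI.
apply: renyi_mixing => //.
- by rewrite normal_cdf_ge0 normal_cdf_le1.
- move=> k; apply: (@hired_limit k (fun c => hired r c k < N k)%N).
  by move=> c c' cc; rewrite (hired_depends_below r cc).
Qed.

Lemma normalized_count_le : \forall n \near \oo,
  (fun w => ((num_accepted r (x w) n)%:R - mu n) / gam n) @^-1` `]-oo, t] = E n.
Proof.
have b0 := threshold_ge0 rP rRV rdiv muP t.
have g0 : \forall n \near \oo, 0 < gam n by exact: (cvgry_gt (beta_y rP rdiv muP)).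
near=> n.
have bn0 : 0 <= mu n + t * gam n by near: n.
have gn0 : 0 < gam n by near: n.
apply/seteqP; split => w;
  rewrite /E /= in_itv /= num_acceptedE// ltnS truncn_ge_nat//;
  by rewrite ler_pdivrMr// lerBlDl.
Unshelve. all: by end_near. Qed.

Lemma normalized_count_mixing (B : set T) : measurable B ->
  P (B `&` (fun w => ((num_accepted r (x w) n)%:R - mu n) / gam n) @^-1` `]-oo, t])
    @[n --> \oo] --> (P B * normal_prob 0 1 `]-oo, t])%E.
Proof.
move=> mB.
have -> : (P B * normal_prob 0 1 `]-oo, t])%E = (fine (P B) * normal_cdf t)%:E.
  by rewrite EFinM !fineK// fin_num_measure.
have c : (fine (P (B `&` E n)))%:E @[n --> \oo] --> (fine (P B) * normal_cdf t)%:E.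
  by apply: cvg_EFin; [exact: nearW|exact: hired_mixing].
apply: cvg_trans c; apply: near_eq_cvg.
apply: filterS normalized_count_le => n ->.
by rewrite fineK// fin_num_measure//; exact: measurableI.
Qed.

End hiring_limit.

Theorem theorem1p3 (R : realType) (d : measure_display) (T : measurableType d)
  (P : probability T R)
  (X : nat -> {RV P >-> R})
  (Xindep : mutually_independent X)
  (Xid : identically_distributed X)
  (Xcont : forall i, continuous (cdf (X i)))
  (r : nat -> nat)
  (rP : rank_sequence r)
  (rRV : regularly_varying (fun m => (r m)%:R : R))
  (rdiv : (\sum_(0 <= m <oo) ((r m)%:R ^- 2 : R)%:E)%E = +oo%E)
  (mu : nat -> R)
  (muP : (fun n => \sum_(1 <= k < (Num.truncn (mu n)).+1) (r k)%:R^-1) =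
         (fun n => ln n%:R) +O_\oo (fun=> 1 : R)) :
  let gamma n := beta r (Num.truncn (mu n)) : R in
  let xi n w :=
    ((num_accepted r (fun i => X i w) n)%:R - mu n) / gamma n in
  cvg_in_distribution P xi (normal_prob 0 1) /\
  mixing_cvg_in_distribution P xi (normal_prob 0 1).
Proof.
move=> gamma xi; split=> [t _|B mB B0 t _].
  (* Plain convergence is the case where B is the whole space. *)
  have := normalized_count_mixing Xindep Xid Xcont rP rRV rdiv muP (t := t) (@measurableT _ T).
  rewrite probability_setT mul1e.
  by under eq_cvg do rewrite setTI.
have PB : (P B != 0)%E by rewrite gt_eqF.
have evB : mrestr P mB setT = P B by rewrite /mrestr setTI.
have condE A : cond_probability P mB A = ((fine (P B))^-1%:E * P (B `&` A))%E.
  (* This unfolds [mnormalize]; its degenerate branch is excluded because P B is positive and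
     finite. *)
  transitivity ((if (mrestr P mB setT == 0) || (mrestr P mB setT == +oo)
    then fun U => P U
    else fun U => mrestr P mB U * (fine (mrestr P mB setT))^-1%:E) A)%E => //.
  rewrite evB (negbTE PB) /= (_ : (P B == +oo)%E = false); last first.
    by apply/negbTE; rewrite -ltey ltey_eq fin_num_measure.
  by rewrite /mrestr muleC setIC.
have c := normalized_count_mixing Xindep Xid Xcont rP rRV rdiv muP (t := t) mB.
have inv L : ((fine (P B))^-1%:E * (P B * L) = L)%E.
  rewrite muleA -[X in (_ * X * _)%E]fineK ?fin_num_measure// -EFinM.
  by rewrite mulVf ?mul1e// fine_eq0 ?fin_num_measure.
under eq_cvg do rewrite condE.
have fB : (fine (P B))^-1%:E \is a fin_num by [].
by have := cvgeZl fB c; rewrite inv.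
Qed.
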